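(* Let $q\ge 5$ be a prime power, let $n,N$ be divisors of $q-1$, let $r$ be a divisor of $\frac{q-1}{n}$ and $R$ a divisor of $\frac{q-1}{N}$. Let $f,F\in\mathbb{F}_q[x]$ be non-constant square-free polynomials such that the ratio $f/F$ is not a constant, and let $D+1\ge 2$ be the number of distinct roots of $f\cdot F$ in its splitting field over $\mathbb{F}_q$. Let $N_{f,F}=N_{f,F}(r,n,R,N)$ be the number of elements $\theta\in\mathbb{F}_q$ such that $f(\theta)$ is $(r,n)$-free and $F(\theta)$ is $(R,N)$-free. Then $$N_{f,F}=\frac{\phi(r)\phi(R)}{rnRN}\big(q+H(r,n,R,N)\big)\quad\text{with}\quad |H(r,n,R,N)|\le D\,n\,N\,W(r)\,W(R)\,q^{1/2}.$$
   Context: Freeness is taken in the cyclic group $\mathcal C_Q=\mathbb{F}_q^*$ of order $Q=q-1$ (so $0$ is never free). For a divisor $n$ of $Q$ and a divisor $r$ of $Q/n$, let $\mathcal C_{Q/n}$ be the subgroup of $\mathbb{F}_q^*$ of order $Q/n$; an element $h\in\mathbb{F}_q^*$ is called $(r,n)$-free if (i) $\mathrm{ord}(h)$ divides $Q/n$, i.e. $h\in\mathcal C_{Q/n}$, and (ii) whenever $h=g^s$ with $g\in\mathcal C_{Q/n}$ and $s\mid r$, then $s=1$. $\phi$ is Euler's totient function and $W(a)$ denotes the number of square-free divisors of the positive integer $a$. *)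

(* Defs.v *)
From HB Require Import structures.
From mathcomp Require Import all_boot all_order all_algebra all_field.
Set Implicit Arguments. Unset Strict Implicit. Unset Printing Implicit Defensive.
Import Order.TTheory GRing.Theory Num.Theory.

Local Open Scope ring_scope.

Definition Qord (K : finFieldType) : nat := #|K|.-1.

(* h lies in the subgroup C_{Q/n} of F_q^*, i.e. h <> 0 and ord(h) | Q/n,
   i.e. h^(Q/n) = 1. *)
Definition inCsub (K : finFieldType) (n : nat) (h : K) : Prop :=
  h != 0 /\ h ^+ (Qord K %/ n) = 1.

Definition rn_free (K : finFieldType) (r n : nat) (h : K) : Prop :=
  inCsub n h /\
  (forall (g : K) (s : nat), inCsub n g -> (s %| r)%N -> h = g ^+ s -> s = 1%N).

Definition sqfree_poly (K : fieldType) (f : {poly K}) : Prop :=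
  forall g : {poly K}, g * g %| f -> (size g <= 1)%N.

Definition sqfree_nat (d : nat) : bool :=
  all (fun p => ~~ (p * p %| d)%N) (primes d).

Definition W (a : nat) : nat := count sqfree_nat (divisors a).

(* Main.v *)
Require Import Defs.
From HB Require Import structures.
From mathcomp Require Import all_boot all_order all_algebra all_field.
From mathcomp Require pgroup abelian.
From mathcomp Require Import cyclic zify ring.
Set Implicit Arguments. Unset Strict Implicit. Unset Printing Implicit Defensive.
Import Order.TTheory GRing.Theory Num.Theory.
Local Open Scope ring_scope.

(* With w a faithful character of K^*, the indicator of the (r,n)-free elements
   is a combination of the powers of w whose coefficients have absolute sum at
   most W(r) phi(r)/r and whose coefficient at the trivial power is phi(r)/(rn).
   This reduces the estimate to |sum_x w (f(x)^a F(x)^b)| <= D sqrt q, the Weil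
   bound for multiplicative characters.

   Let lam be the multiplicative function on monic G given by
   lam G = w (N_f(G)^a N_F(G)^b), with N_f(G) the norm of G in K[X]/(f), and let
   c_n be the sum of lam over the monic polynomials of degree n.  The function
   lam only depends on residues modulo the radical M of f F, hence c_n = 0 for
   n > D, and logarithmic differentiation of sum_n c_n X^n turns its inverse
   roots z into the character sums S_n = - sum_z z^n over the extension of K of
   degree n.  Stepanov's method, in Bombieri's form where an auxiliary polynomial
   is raised to the power s = q^t, bounds S_(2t) by a constant times q^t, which
   forces |z| <= sqrt q for each of the at most D roots; the sum to be bounded
   is c_1 = - sum_z z up to a factor of modulus 1. *)

(** Stepanov's method bounds a fibre from above only. That suffices because the fibres of the norm
    of h(x) over the d-th roots of unity together exhaust the q^(2t) points up to the zeros of h, so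
    none can fall far below its share. The constant it yields is far from the wanted one. This is
    harmless because the roots z do not depend on the level: a bound at all large levels constrains
    the same finite list, and the constant disappears as t grows. The levels are even because, with
    s = q^t, the map x -> x^s is an involution of the field with s^2 elements: raising the auxiliary
    polynomial to the power s brings x^(s^2) back to x and keeps its degree near s^2 / d. No
    algebraic closure is used. Each level has its own finite field E, large enough to split the
    polynomials concerned, and the extension of degree n is the set of points of E fixed by x ->
    x^(q^n). The list of z must therefore be found from the c_n alone, before any E is chosen. *)

(** * Norms from K[X]/(p) as determinants in the companion algebra *)

Lemma char_poly_surj (R : comNzRingType) (p : {poly R}) :
  p \is monic -> (1 < size p)%N ->
  exists n (C : 'M[R]_n.+1), char_poly C = p.
Proof.
move=> mon_p sz_p; move: (companionmxK mon_p) sz_p; move: (companionmx p).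
case: (size p) => [|[|n]] //= C CP _; by exists n, C.
Qed.

(** For C with characteristic polynomial f this is the norm of G from K[X]/(f), that is, the
    resultant of f and G up to sign. The determinant makes multiplicativity in G immediate without
    naming any root of f. *)
Definition polynorm (R : comNzRingType) n (C : 'M[R]_n.+1) (G : {poly R}) :=
  \det (horner_mx C G).

Lemma polynormM (R : comNzRingType) n (C : 'M[R]_n.+1) G H :
  polynorm C (G * H) = polynorm C G * polynorm C H.
Proof. by rewrite /polynorm rmorphM det_mulmx. Qed.

Lemma polynorm1 (R : comNzRingType) n (C : 'M[R]_n.+1) : polynorm C 1 = 1.
Proof. by rewrite /polynorm rmorph1 det1. Qed.

Lemma polynorm_mod (F : fieldType) n (C : 'M[F]_n.+1) G H :
  char_poly C %| G - H -> polynorm C G = polynorm C H.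
Proof.
case/dvdpP=> q defq; rewrite -(subrK H G) defq /polynorm rmorphD rmorphM /=.
by rewrite Cayley_Hamilton mulr0 add0r.
Qed.

Lemma polynorm_split (R S : comNzRingType) (j : {rmorphism R -> S}) n
    (C : 'M[R]_n.+1) (G : {poly R}) (rs : seq S) :
  map_poly j G = \prod_(x <- rs) ('X - x%:P) ->
  j (polynorm C G) =
    \prod_(x <- rs) ((-1) ^+ n.+1 * (map_poly j (char_poly C)).[x]).
Proof.
move=> defG; rewrite /polynorm -det_map_mx map_horner_mx defG rmorph_prod /=.
rewrite (big_morph (fun A : 'M[S]_n.+1 => \det A) (@det_mulmx _ _) (det1 _ _)).
apply: eq_bigr => x _; rewrite map_char_poly rmorphB /= horner_mx_X horner_mx_C.
set A := map_mx j C.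
have -> : A - x%:M = (-1) *: map_mx (horner_eval x) (char_poly_mx A).
  apply/matrixP=> i k; rewrite !mxE /horner_eval /= mulN1r.
  by rewrite !hornerE hornerMn hornerX opprB.
by rewrite detZ det_map_mx.
Qed.

(** * Kummer theory over a field of rational functions *)

Lemma size_det_leq (R : idomainType) n (A : 'M[{poly R}]_n) e :
  (forall i j, (size (A i j) <= e.+1)%N) -> (size (\det A) <= (n * e).+1)%N.
Proof.
move=> szA; apply: leq_trans (size_sum _ _ _) _; apply/bigmax_leqP=> s _.
rewrite -signr_odd; set p := \prod_i _.
have : (size p <= (n * e).+1)%N.
  apply: leq_trans (size_prod_leq _ _) _.
  rewrite cardE size_enum_ord leq_subLR addnS ltnS.
  have -> : (n + n * e = \sum_(i < n) e.+1)%N.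
    by rewrite sum_nat_const card_ord mulnS.
  exact: leq_sum.
by case: (odd _); rewrite /= ?expr1 ?expr0 ?mulN1r ?mul1r ?size_polyN.
Qed.

Section Fraction.
Import FracField.
Lemma fracP (R : idomainType) (w : {fraction R}) :
  exists u v : R, v != 0 /\ w = tofrac u / tofrac v.
Proof.
exists (frac (generic_quotient.repr w)).1, (frac (generic_quotient.repr w)).2.
have dn0 := denom_ratioP (generic_quotient.repr w).
split=> //; apply: (mulIf (_ : tofrac (frac (generic_quotient.repr w)).2 != 0)).
  by rewrite tofrac_eq0.
rewrite divfK ?tofrac_eq0 //.
rewrite -[X in X * _ = _]generic_quotient.reprK.
move: (generic_quotient.repr w) dn0 => x dn0.
rewrite !generic_quotient.piE /=; apply/generic_quotient.eqmodP.
rewrite /= equivfE /mulf !numden_Ratio ?mulf_neq0 ?oner_neq0 //.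
by rewrite /= !mulr1 mulrC.
Qed.
End Fraction.

(** The witness is the norm of a root of G: the companion matrix C of the normalised G satisfies C^N
    = a, and determinants turn this into an identity in M. G may be reducible. *)
Lemma root_power (M : fieldType) (G : {poly M}) N a :
  G %| 'X^N - a%:P -> (1 < size G)%N -> exists w : M, w ^+ N = a ^+ (size G).-1.
Proof.
move=> dvG szG; have G0 : G != 0 by rewrite -size_poly_gt0 ltnW.
pose G' := (lead_coef G)^-1 *: G.
have l0 : (lead_coef G)^-1 != 0 by rewrite invr_eq0 lead_coef_eq0.
have monG' : G' \is monic by rewrite monicE lead_coefZ mulVf // lead_coef_eq0.
have szG' : size G' = size G by rewrite size_scale.
have [n [C CP]] : exists n (C : 'M[M]_n.+1), char_poly C = G'.
  by apply: char_poly_surj; rewrite // szG'.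
have szn : (size G).-1 = n.+1 by rewrite -szG' -CP size_char_poly.
have : horner_mx C ('X^N - a%:P) = 0.
  have /dvdpP[r ->] : G' %| 'X^N - a%:P by rewrite dvdpZl.
  by rewrite rmorphM /= -CP Cayley_Hamilton mulr0.
rewrite rmorphB /= rmorphXn /= horner_mx_X horner_mx_C => /subr0_eq CN.
exists (\det C); rewrite szn -(det_scalar _ a) -CN.
elim: N {dvG CN} => [|N IH]; first by rewrite !expr0 det1.
by rewrite !exprS detM IH.
Qed.

Lemma mupX (F : fieldType) (p : {poly F}) n x : p != 0 -> mup x (p ^+ n) = (n * mup x p)%N.
Proof.
move=> p0; elim: n => [|n IH]; first by rewrite expr0 mupNroot // root1.
by rewrite exprS mupM ?expf_neq0 // IH mulSn.
Qed.

(* A factor of h Z^N - c of degree k forces h^k to be an N-th power up to a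
   constant: take the determinant of a root in the companion algebra. *)
Lemma kummer_factor (F : fieldType) (h : {poly F}) (c : F) N
    (G : {poly {poly F}}) r :
  h != 0 -> c != 0 -> (0 < N)%N -> (1 < size G)%N ->
  G %| h *: 'X^N - c%:P%:P -> (N %| (size G).-1 * mup r h)%N.
Proof.
move=> h0 c0 N0 szG.
pose f : {rmorphism {poly F} -> {fraction {poly F}}} := @FracField.tofrac {poly F}.
have finj : injective f by move=> x y /eqP; rewrite tofrac_eq => /eqP.
case/Pdiv.Idomain.dvdpP=> [[e qq]] /= e0 /(congr1 (map_poly f)) E.
have szfG : size (map_poly f G) = size G.
  by rewrite size_map_inj_poly ?rmorph0.
have f0 p : p != 0 -> f p != 0 by move=> p0; rewrite tofrac_eq0.
have dv : map_poly f G %| 'X^N - (f c%:P / f h)%:P.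
  have <- : map_poly f G %| f e *: (f h *: ('X^N - (f c%:P / f h)%:P)) =
            (map_poly f G %| 'X^N - (f c%:P / f h)%:P).
    by rewrite !dvdpZr ?f0.
  rewrite [f h *: _]scalerBr -[f h *: _%:P]mul_polyC -polyCM mulrC divfK ?f0 //.
  move: E; rewrite linearZ /= rmorphB /= linearZ /= map_polyXn map_polyC rmorphM /=.
  by move=> ->; rewrite dvdp_mull.
have [|w] := root_power dv; first by rewrite szfG.
rewrite szfG.
set k := (size G).-1; have [u [v [v0 ->]]] := fracP w => Ew.
have {}Ew : u ^+ N * h ^+ k = c%:P ^+ k * v ^+ N.
  apply: finj; rewrite !rmorphM !rmorphXn /=; move: Ew.
  rewrite !expr_div_n => /eqP; rewrite eqr_div ?expf_neq0 ?f0 // => /eqP ->.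
  by rewrite mulrC.
have cP0 : c%:P != 0 :> {poly F} by rewrite polyC_eq0.
have u0 : u != 0.
  apply/eqP=> u0; move/esym/eqP: Ew; rewrite u0 expr0n gtn_eqF // mul0r.
  by apply/negP; rewrite mulf_neq0 ?expf_neq0.
move/(congr1 (mup r)): Ew.
rewrite !mupM ?expf_neq0 // !mupX //.
rewrite [mup r c%:P]mupNroot ?rootC // muln0 add0n => E'.
by rewrite -(dvdn_addr _ (dvdn_mulr (mup r u) (dvdnn N))) E' dvdn_mulr.
Qed.

Lemma pnat_pchar_poly (R : nzRingType) n :
  [pchar R].-nat n -> [pchar {poly R}].-nat n.
Proof. by apply: sub_in_pnat => p _; rewrite pchar_poly. Qed.

Section Independence.
Variables (F : fieldType) (h : {poly F}) (x0 : F) (s N k d e : nat).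
Hypotheses (char_s : [pchar F].-nat s) (def_s : s = (N * k).+1) (N_gt0 : (0 < N)%N).
Hypothesis hx0 : h.[x0] != 0.
Hypothesis Hd : forall i, (forall r, N %| i * mup r h)%N -> (d %| i)%N.

(* Put g = h^k.  Then h g^N = h^s is congruent to the constant h(x0)^s modulo
   (X - x0)^s, so that g behaves like an N-th root of c/h: a relation
   sum_l b_l g^l = 0 modulo (X - x0)^s makes the resultant of sum_l b_l Z^l and
   h Z^N - c vanish, its degree being too small otherwise. *)
Lemma stepanov_indep (b : nat -> {poly F}) :
  (forall l, size (b l) <= e.+1)%N -> (size h <= e.+1)%N -> ((N + d) * e < s)%N ->
  ('X - x0%:P) ^+ s %| \sum_(l < d) b l * h ^+ (k * l) ->
  forall l, (l < d)%N -> b l = 0.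
Proof.
move=> sz_b sz_h lt_s dv_s l ltl; apply/eqP/negPn/negP => bl0.
pose p : {poly {poly F}} := \poly_(l < d) b l.
pose c := h.[x0] ^+ s; pose q0 := h *: 'X^N - c%:P%:P.
have h0 : h != 0 by apply: contraNneq hx0 => ->; rewrite horner0.
have c0 : c != 0 by rewrite expf_neq0.
have p0 : p != 0.
  by apply/eqP=> /(congr1 (coefp l)) /eqP; rewrite /= coef_poly ltl coef0 (negPf bl0).
have szp : (size p <= d)%N by exact: size_poly.
have szq : size q0 = N.+1.
  rewrite size_polyDl size_scale // size_polyXn // size_polyN size_polyC.
  by rewrite polyC_eq0 c0 ltnS.
have small r : ('X - x0%:P) ^+ s %| r -> (size r <= s)%N -> r = 0.
  move=> dv szr; apply/eqP; apply: contraLR dv => r0.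
  by apply/negP=> /(dvdp_leq r0); rewrite size_exp_XsubC ltnNge szr.
have lt_e : (e < s)%N.
  by apply: leq_ltn_trans lt_s; rewrite leq_pmull // addn_gt0 N_gt0.
pose g := h ^+ k.
have pg : p.[g] = \sum_(l < d) b l * h ^+ (k * l).
  by rewrite horner_poly; apply: eq_bigr => i _; rewrite exprM.
(* [resultant_in_ideal] wants both polynomials nonconstant in Z. A constant p is its own value at g,
   and its size alone forces it to vanish. *)
have [sz1|szp1] := leqP (size p) 1.
  have ep := size1_polyC sz1.
  have E : p.[g] = p`_0 by rewrite [in LHS]ep hornerC.
  have p00 : p`_0 != 0 by apply: contraNneq p0 => E0; rewrite ep E0.
  case/negP: p00; apply/eqP/small; first by rewrite -E pg.
  rewrite coef_poly; case: ifP => _; last by rewrite size_poly0.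
  exact: leq_trans (sz_b 0%N) lt_e.
have q0g : ('X - x0%:P) ^+ s %| q0.[g].
  have -> : q0.[g] = (h - h.[x0]%:P) ^+ s.
    rewrite exprDn_pchar ?pnat_pchar_poly // exprNn_pchar ?pnat_pchar_poly //.
    by rewrite -rmorphXn !hornerE /g -exprM mulnC -exprS -def_s.
  by apply: dvdp_exp2r; rewrite dvdp_XsubCl rootE !hornerE subrr.
have [||[u v] _ E] := @resultant_in_ideal _ p q0.
- by [].
- by rewrite szq.
have res0 : resultant p q0 = 0.
  apply: small.
    have -> : resultant p q0 = u.[g] * p.[g] + v.[g] * q0.[g].
      by rewrite -[LHS](hornerC _ g) E hornerD !hornerM.
    by apply: dvdp_add; apply: dvdp_mull; rewrite ?pg.
  (* The Sylvester matrix has order deg p + N, less than d + N, and entries of degree at most e in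
     X. The resultant thus has degree below s while being divisible by (X - x0)^s. *)
  apply: leq_trans (size_det_leq (e := e) _) _.
    move=> i j; rewrite Sylvester_mxE.
    have sz_n (r : {poly F}) (t : bool) :
        (size r <= e.+1)%N -> (size (r *+ t) <= e.+1)%N.
      by case: t; rewrite ?mulr1n ?mulr0n ?size_poly0.
    case: (split i) => i'; apply: sz_n.
      by rewrite coef_poly; case: ifP => _; rewrite ?sz_b ?size_poly0.
    rewrite /q0 coefB coefZ coefXn coefC.
    case: eqP => [->|_]; first by rewrite gtn_eqF // mulr1 subr0.
    rewrite mulr0 sub0r size_polyN; case: eqP => _; rewrite ?size_poly0 //.
    by rewrite (leq_trans (size_polyC_leq1 _)).
  apply: leq_ltn_trans lt_s.
  by rewrite leq_mul2r szq leq_add2l (leq_trans (leq_pred _)) ?orbT.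
(* A vanishing resultant gives a common factor of degree between 1 and d - 1, whereas
   [kummer_factor] and [Hd] make d divide that degree. *)
move/eqP: res0; rewrite resultant_eq0 => szG.
set G := gcdp p q0 in szG.
have /Hd : forall r, (N %| (size G).-1 * mup r h)%N.
  by move=> r; apply: (kummer_factor (c := c)) => //; apply: dvdp_gcdr.
have Gp : (size G <= size p)%N by rewrite dvdp_leq ?dvdp_gcdl.
move/dvdn_leq; move: szG Gp szp; case: (size G) => [|[|g']] //= _ le1 le2 /(_ isT) le3.
by have := leq_trans le1 (leq_trans le2 le3); rewrite ltnn.
Qed.
End Independence.

(** * Stepanov's method *)

Lemma poly_lindep (F : fieldType) (T : finType) (p : T -> {poly F}) n :
  (forall t, size (p t) <= n)%N -> (n < #|T|)%N ->
  exists g : T -> F, (exists t, g t != 0) /\ \sum_t g t *: p t = 0.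
Proof.
move=> szp ltn; pose M : 'M[F]_(#|T|, n) := \matrix_i poly_rV (p (enum_val i)).
have /rowV0Pn[v /sub_kermxP vM v0] : kermx M != 0.
  by rewrite kermx_eq0 -row_leq_rank -ltnNge (leq_ltn_trans (rank_leq_col _)).
exists (fun t => v 0 (enum_rank t)); split.
  have [i vi] : exists i, v 0 i != 0.
    apply/existsP; apply: contraNT v0 => /existsPn vz.
    by apply/eqP/rowP=> i; rewrite mxE; apply/eqP/negPn/vz.
  by exists (enum_val i); rewrite enum_valK.
rewrite (reindex_onto (@enum_val T T) enum_rank) /=; last first.
  by move=> t _; rewrite enum_rankK.
move/(congr1 rVpoly): vM; rewrite linear0 => {2}<-.
rewrite mulmx_sum_row linear_sum; apply: eq_big => i; first by rewrite enum_valK eqxx.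
by move=> _; rewrite linearZ /= rowK poly_rV_K // enum_valK.
Qed.

Lemma finField_root_surj (F : finFieldType) s (y : F) :
  [pchar F].-nat s -> exists x : F, x ^+ s = y.
Proof.
move=> char_s.
have inj : injective (fun x : F => x ^+ s).
  move=> x y' /eqP; rewrite -subr_eq0 -exprNn_pchar // -exprDn_pchar //.
  rewrite expf_eq0 subr_eq0 => /andP[_ /eqP //].
by have [g _ gK] := injF_bij inj; exists (g y); rewrite gK.
Qed.

Lemma exprD_pchar_sum (R : comNzRingType) s (I : finType) (f : I -> R) :
  [pchar R].-nat s -> (\sum_i f i) ^+ s = \sum_i f i ^+ s.
Proof.
move=> char_s.
have z : (0 : R) ^+ s = 0 by case/andP: char_s => s0 _; rewrite expr0n gtn_eqF.
apply: (big_ind2 (fun x y => x ^+ s = y)) => // x _ y _ <- <-.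
exact: exprDn_pchar.
Qed.

(** In the application s = q^t and k = (s - 1)/(q - 1), so that k(s + 1) = (s^2 - 1)/(q - 1) is the
    exponent of the norm from the field with s^2 elements down to K. *)
Definition norm_fiber (F : finFieldType) (h : {poly F}) s k (z : F) :=
  [set x : F | [&& x ^+ (s * s) == x, h.[x] != 0 & h.[x] ^+ (k * s.+1) == z]].

Section Count.
Variables (F : finFieldType) (h : {poly F}) (x0 : F) (s N k d A B e : nat) (z : F).
Hypotheses (char_s : [pchar F].-nat s) (def_s : s = (N * k).+1) (N_gt0 : (0 < N)%N).
Hypotheses (hx0 : h.[x0] != 0) (x0_fix : x0 ^+ (s * s) = x0).
Hypothesis Hd : forall i, (forall r, N %| i * mup r h)%N -> (d %| i)%N.
Hypotheses (d_gt0 : (0 < d)%N) (d_le : (d <= N)%N).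
Hypotheses (A_le : (A <= e.+1)%N) (szh : (size h <= e.+1)%N) (lt_s : ((N + d) * e < s)%N).
Hypothesis many : (s * A + s * size h + B < d * A * B)%N.

(* The auxiliary polynomial is R = sum a_jl h^(kl) (X - x0)^(sj).  At a point of
   the fibre, R^s agrees up to a power of h with a polynomial in which x^(s^2)
   has been replaced by x; its coefficients are linear in the s-th powers of
   those of the a_jl, and dimension counting makes it vanish identically. *)
Lemma stepanov_count :
  (#|norm_fiber h s k z| <= A + s * size h + s * B)%N.
Proof.
set P := norm_fiber h s k z.
pose T := ('I_B * ('I_d * 'I_A))%type.
(* At a point of the fibre this is the s-th power of the term of R with indices (j, l, i),
   multiplied by h^(k(d-1)): the exponent of h splits as kls + k(d-1) = k(s+1)l + k(d-1-l), and
   h^(k(s+1)) takes the value z. The extra factor keeps the remaining exponent of h nonnegative. *)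
pose p (t : T) : {poly F} := z ^+ t.2.1 *:
  ('X^(t.2.2 * s) * h ^+ (k * (d.-1 - t.2.1)) * ('X - x0%:P) ^+ t.1).
have kd l : (k * (d.-1 - l) * (size h).-1 <= s * size h)%N.
  apply: leq_mul; last exact: leq_pred.
  by rewrite def_s mulnC leqW // leq_mul // (leq_trans (leq_subr _ _)) // (leq_trans (leq_pred _)).
have size3 (a b c : {poly F}) (u v w : nat) :
    (size a <= u.+1)%N -> (size b <= v.+1)%N -> (size c <= w.+1)%N ->
    (size (a * b * c)%R <= (u + v + w).+1)%N.
  move=> sa sb sc; apply: leq_trans (size_polyMleq _ _) _.
  have := size_polyMleq a b; lia.
have szX n : (size (h ^+ n) <= (n * (size h).-1).+1)%N.
  by rewrite mulnC size_poly_exp_leq.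
have [] := @poly_lindep _ T p (s * A + s * size h + B)%N.
- move=> [j [l i]]; rewrite /p /=; apply: leq_trans (size_scale_leq _ _) _.
  apply: leq_trans (size3 _ _ _ (i * s)%N (s * size h)%N j _ _ _) _.
  + by rewrite size_polyXn.
  + by apply: leq_trans (szX _) _; rewrite ltnS kd.
  + by rewrite size_exp_XsubC.
  have := ltn_ord j; have : (i * s + s <= s * A)%N.
    by rewrite -mulSnr mulnC leq_mul // ltn_ord.
  have : (0 < s)%N by rewrite def_s.
  move: (i * s)%N (s * A)%N (s * size h)%N (nat_of_ord j) => *; lia.
- by rewrite !card_prod !card_ord; lia.
move=> g [[[j0 [l0 i0]] gt0] sum0].
have /fin_all_exists[c cE] : forall t, exists x, x ^+ s = g t.
  by move=> t; apply: finField_root_surj.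
pose b (j : 'I_B) (l : nat) : {poly F} :=
  \poly_(i < A) (if insub l is Some l' then if insub i is Some i' then c (j, (l', i')) else 0 else 0).
have bE j (l : 'I_d) : b j l = \sum_(i < A) c (j, (l, i)) *: 'X^i.
  by rewrite /b poly_def; apply: eq_bigr => i _; rewrite !valK.
pose r j := \sum_(l < d) b j l * h ^+ (k * l).
pose R := \sum_j r j * ('X - x0%:P) ^+ (s * j).
have RE : R = \sum_(t : T) c t *:
    ('X^(t.2.2) * h ^+ (k * t.2.1) * ('X - x0%:P) ^+ (s * t.1)).
  transitivity (\sum_(j < B) \sum_(l < d) \sum_(i < A) c (j, (l, i)) *:
      ('X^i * h ^+ (k * l) * ('X - x0%:P) ^+ (s * j))).
    apply: eq_bigr => j _; rewrite /r mulr_suml; apply: eq_bigr => l _.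
    by rewrite bE !mulr_suml; apply: eq_bigr => i _; rewrite -!scalerAl.
  under eq_bigr do rewrite pair_bigA /=.
  by rewrite pair_bigA /=; apply: eq_bigr => -[j [l i]].
have R0 : R != 0.
  apply/eqP=> R0.
  (* Induction on j: if the coefficients of smaller index vanish, the other terms of R = 0 are
     divisible by (X - x0)^(s(j+1)), so (X - x0)^s divides r j and [stepanov_indep] applies. *)
  have b0 : forall n (j : 'I_B), j = n :> nat -> forall l, (l < d)%N -> b j l = 0.
    elim/ltn_ind => n IH j jn.
    apply: (stepanov_indep char_s def_s N_gt0 hx0 Hd _ szh lt_s).
      by move=> l; apply: leq_trans (size_poly _ _) A_le.
    rewrite -/(r j) -(@dvdp_mul2r _ (('X - x0%:P) ^+ (s * j))); last first.
      by rewrite expf_neq0 // polyXsubC_eq0.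
    have -> : r j * ('X - x0%:P) ^+ (s * j) =
       - \sum_(j' | j' != j) r j' * ('X - x0%:P) ^+ (s * j').
      by apply/eqP; rewrite -addr_eq0; apply/eqP; rewrite -[RHS]R0 [RHS](bigD1 j).
    rewrite dvdpNr; apply: (big_ind (fun p => _ %| p)) => [|? ?|j' neq]; [exact: dvdp0|exact: dvdp_add|].
    case: (ltngtP j' j) => [lt|gt|/val_inj /eqP]; last by rewrite (negPf neq).
      rewrite /r big1 ?mul0r ?dvdp0 // => l _.
      by rewrite (IH j' _ j' erefl l (ltn_ord l)) ?mul0r // -jn.
    by rewrite -exprD dvdp_mull // dvdp_exp2l // -mulnS leq_mul.
  have ct0 : c (j0, (l0, i0)) != 0.
    by apply: contraNneq gt0 => ct; rewrite -cE ct expr0n gtn_eqF // def_s.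
  have := congr1 (coefp i0) (b0 _ j0 erefl l0 (ltn_ord l0)).
  by rewrite /= coef0 coef_poly ltn_ord !valK => /eqP; rewrite (negPf ct0).
have rootR x : x \in P -> root R x.
  rewrite inE => /and3P[/eqP xfix hx /eqP hz].
  suff : (R.[x] ^+ s) * h.[x] ^+ (k * d.-1) = 0.
    move/eqP; rewrite mulf_eq0 !expf_eq0 => /orP[/andP[_ //]|/andP[_]].
    by rewrite (negPf hx).
  have -> : R.[x] ^+ s * h.[x] ^+ (k * d.-1) = (\sum_t g t *: p t).[x]; last first.
    by rewrite sum0 horner0.
  rewrite RE !horner_sum exprD_pchar_sum // mulr_suml; apply: eq_bigr => -[j [l i]] _.
  have xx0 : (x - x0) ^+ (s * s) = x - x0.
    have cs2 : [pchar F].-nat (s * s) by rewrite pnatM char_s.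
    by rewrite exprDn_pchar // exprNn_pchar // xfix x0_fix.
  have E1 : (x - x0) ^+ (s * j * s) = (x - x0) ^+ j by rewrite mulnAC exprM xx0.
  have E2 : h.[x] ^+ (k * l * s) * h.[x] ^+ (k * d.-1) =
            h.[x] ^+ (k * s.+1 * l) * h.[x] ^+ (k * (d.-1 - l)).
    rewrite -!exprD; congr (_ ^+ _).
    have ld : (l <= d.-1)%N by rewrite -ltnS prednK.
    rewrite -{1}(subnKC ld); move: (d.-1 - l)%N => u; lia.
  rewrite /p !hornerZ !hornerM !horner_exp !hornerXsubC hornerX /= -cE -hz.
  rewrite !exprMn -!exprM E1; move: E2.
  move: (_ ^+ (k * l * s)) (_ ^+ (k * d.-1)) (_ ^+ (k * s.+1 * l)) => h1 h2 h3.
  move: (_ ^+ (k * _)) => h4 E2.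
  by ring: E2.
have szR : (size R <= (A + s * size h + s * B).+1)%N.
  rewrite RE; apply: leq_trans (size_sum _ _ _) _; apply/bigmax_leqP=> -[j [l i]] _ /=.
  apply: leq_trans (size_scale_leq _ _) _.
  apply: leq_trans (size3 _ _ _ i (s * size h)%N (s * j)%N _ _ _) _.
  + by rewrite size_polyXn.
  + apply: leq_trans (szX _) _; rewrite ltnS; apply: leq_mul; last exact: leq_pred.
    by rewrite def_s mulnC leqW // leq_mul // (leq_trans _ d_le) // ltnW.
  + by rewrite size_exp_XsubC.
  by rewrite ltnS !leq_add // ?leq_mul // ltnW.
rewrite -ltnS cardE; apply: leq_trans (szR).
apply: max_poly_roots R0 _ (enum_uniq _); apply/allP => x.
by rewrite mem_enum; apply: rootR.
Qed.
End Count.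

(** * Faithful multiplicative characters, and the choice of parameters in Stepanov's bound *)

Definition faithful_char (K : finFieldType) (w : K -> algC) :=
  [/\ w 0 = 0, w 1 = 1, {morph w : x y / x * y} & forall x, w x = 1 -> x = 1].

Lemma expf_card1 (K : finFieldType) (x : K) : x != 0 -> x ^+ #|K|.-1 = 1.
Proof.
move=> x0; apply: (mulfI x0); rewrite -exprS prednK ?expf_card ?mulr1 //.
by apply/card_gt0P; exists x.
Qed.

Lemma finField_prim_root (K : finFieldType) : exists g : K, #|K|.-1.-primitive_root g.
Proof.
set N := #|K|.-1.
have N0 : (0 < N)%N by rewrite -ltnS prednK ?finNzRing_gt1 // ltnW ?finNzRing_gt1.
have /hasP[g _ prim_g] : has N.-primitive_root (enum [pred x : K | x != 0]).
  apply: has_prim_root => //; last 2 first.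
  - exact: enum_uniq.
  - rewrite -cardE /N -(cardC1 (0 : K)); apply: eq_leq; exact: eq_card.
  by apply/allP=> x; rewrite mem_enum inE => x0; apply/unity_rootP/expf_card1.
by exists g.
Qed.

Lemma faithful_char_exists (K : finFieldType) : exists w : K -> algC, faithful_char w.
Proof.
pose N := #|K|.-1.
have N0 : (0 < N)%N by rewrite -ltnS prednK ?finNzRing_gt1 // ltnW ?finNzRing_gt1.
have [z prim_z] := C_prim_root_exists N0.
have [g prim_g] := finField_prim_root K.
pose l x := if [pick i : 'I_N | x == g ^+ i] is Some i then val i else 0%N.
have lE x : x != 0 -> g ^+ l x = x.
  rewrite /l; case: pickP => [i /eqP // | none] /expf_card1 /(prim_rootP prim_g)[i xi].
  by move: (none i); rewrite xi eqxx.
have zg i i' : g ^+ i = g ^+ i' -> z ^+ i = z ^+ i'.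
  by move/eqP; rewrite (eq_prim_root_expr prim_g) -(eq_prim_root_expr prim_z) => /eqP.
exists (fun x => if x == 0 then 0 else z ^+ l x); split.
- by rewrite eqxx.
- by rewrite oner_eq0 -(expr0 z); apply: zg; rewrite lE ?oner_eq0.
- move=> x y; rewrite mulf_eq0; case: eqVneq => [_|x0] /=; first by rewrite mul0r.
  case: eqVneq => [_|y0]; first by rewrite mulr0.
  by rewrite -exprD; apply: zg; rewrite exprD !lE ?mulf_neq0.
move=> x; case: eqVneq => [_ /esym/eqP|x0]; first by rewrite oner_eq0.
move/eqP; rewrite -(prim_order_dvd prim_z) (prim_order_dvd prim_g) lE //.
by move/eqP.
Qed.

Section FaithfulChar.
Variables (K : finFieldType) (w : K -> algC).
Hypothesis wP : faithful_char w.

Lemma fchar0 : w 0 = 0. Proof. by case: wP. Qed.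
Lemma fchar1 : w 1 = 1. Proof. by case: wP. Qed.
Lemma fcharM : {morph w : x y / x * y}. Proof. by case: wP. Qed.
Lemma fcharX x n : w (x ^+ n) = w x ^+ n.
Proof. by elim: n => [|n IH]; rewrite ?expr0 ?fchar1 // !exprS fcharM IH. Qed.

Lemma norm_fchar x : x != 0 -> `|w x| = 1.
Proof.
move=> x0; apply/eqP; have N0 : (0 < #|K|.-1)%N.
  by rewrite -ltnS prednK ?finNzRing_gt1 // ltnW ?finNzRing_gt1.
by rewrite -(pexpr_eq1 N0) // -normrX -fcharX expf_card1 // fchar1 normr1.
Qed.

Lemma norm_fchar_le1 x : `|w x| <= 1.
Proof. by have [->|/norm_fchar ->] := eqVneq x 0; rewrite ?fchar0 ?normr0 ?ler01. Qed.

Lemma sum_fchar_unity d : (1 < d)%N -> (d %| #|K|.-1)%N ->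
  \sum_(z : K | z ^+ d == 1) w z = 0 /\ #|[pred z : K | z ^+ d == 1]| = d.
Proof.
move=> d1 dN; have [g prim_g] := finField_prim_root K.
have := dvdn_prim_root prim_g dN; move: (g ^+ _) => a prim_a.
have ad : a ^+ d = 1 := prim_expr_order prim_a.
split; last first.
  rewrite -[RHS]card_ord -(card_codom (f := fun i : 'I_d => a ^+ i)).
    apply: eq_card => z; rewrite !inE; apply/eqP/codomP.
      by case/(prim_rootP prim_a)=> i zi; exists i.
    by case=> i ->; rewrite exprAC ad expr1n.
  move=> i i' /eqP; rewrite (eq_prim_root_expr prim_a) !modn_small ?ltn_ord //.
  by move/eqP/val_inj.
have a0 : a != 0.
  by apply/eqP=> a0; move/eqP: ad; rewrite a0 expr0n gtn_eqF ?(ltnW d1) // eq_sym oner_eq0.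
have wa : 1 - w a != 0.
  rewrite subr_eq0; apply: contraTneq prim_a => /esym wa1.
  case: wP => _ _ _ /(_ _ wa1) ->; apply/negP=> /prim_order_dvd /(_ 1%N).
  by rewrite expr1 eqxx dvdn1 gtn_eqF.
apply: (mulfI wa); rewrite mulr0 mulrBl mul1r.
rewrite [X in X - _](reindex_inj (mulfI a0)) /= mulr_sumr.
under eq_bigl do rewrite exprMn ad mul1r.
by under eq_bigr do rewrite fcharM; rewrite subrr.
Qed.
End FaithfulChar.

(* The constant for which A = q^(t-2) and B = s/d + (q^2 (m+1) + 1) work below. *)
Definition stepC q m := (q * (1 + m + (q ^ 2 * m.+1).+1))%N.

(** Each of the d fibres gets at most its share of the s^2 points, up to an error linear in s.
    Multiplying by d avoids dividing s^2 by d. *)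
Lemma stepanov_bound (F : finFieldType) (h : {poly F}) (x0 : F) q t k d z :
  (1 < q)%N -> [pchar F].-nat (q ^ t)%N -> (q ^ t = (q.-1 * k).+1)%N ->
  h.[x0] != 0 -> x0 ^+ (q ^ t * q ^ t)%N = x0 ->
  (forall i, (forall r, q.-1 %| i * mup r h)%N -> (d %| i)%N) ->
  (0 < d <= q.-1)%N -> (1 < t)%N -> ((q ^ 2 * (size h).+1).+1 < q ^ (t - 2))%N ->
  (d * #|norm_fiber h (q ^ t) k z| <= q ^ t * q ^ t + q ^ t * stepC q (size h))%N.
Proof.
move=> q1 char_s def_s hx0 x0fix Hd /andP[d0 dN] t1 big.
(* A = s / q^2 is small enough that (N + d) A <= 2 (q - 1) A < s, as linear independence requires,
   and large enough that A q^2 (m + 1) = s m + s pays for the terms of the dimension count not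
   proportional to A. *)
set A := (q ^ (t - 2))%N in big; set s := (q ^ t)%N in char_s def_s x0fix *.
have sA : s = (q ^ 2 * A)%N by rewrite /s /A -expnD subnKC.
set m := size h in big *; set C1 := (q ^ 2 * m.+1).+1 in big.
have mA : (m <= A)%N by rewrite ltnW // (leq_trans _ (ltnW big)) // -addn1 ltnW //; nia.
pose B := (s %/ d + C1)%N.
have dB1 : (d * (s %/ d) <= s)%N by rewrite mulnC leq_trunc_div.
have dB2 : (s < d * (s %/ d) + d)%N.
  by rewrite {1}(divn_eq s d) mulnC ltn_add2l ltn_mod.
have Bs : (s %/ d <= s)%N by apply: leq_div.
have q2 : (2 * q.-1 < q ^ 2)%N by nia.
apply: leq_trans (leq_mul (leqnn d) (@stepanov_count F h x0 s q.-1 k d A B A z _ _ _ _ _ _ _ _ _ _ _ _)) _ => //.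
- by rewrite -ltnS prednK // ltnW.
- by rewrite ltnW // ltnS.
- by rewrite sA; nia.
- rewrite -/m.
  (* The final unit of C1 covers the rounding in s / d, so d A B >= A (s + 1) + s m + s. As B <= s +
     C1, the surplus A > C1 granted by [big] closes the count. *)
  have dC : (d * (C1.-1) >= C1.-1)%N by rewrite leq_pmull.
  have AdC : (A * C1.-1 <= A * (d * C1.-1))%N by rewrite leq_mul2l dC orbT.
  have -> : (d * A * B = A * (d * (s %/ d)) + A * (d * C1.-1) + A * d)%N.
    by rewrite /B /C1 /=; lia.
  have E1 : (A * C1.-1 = s * m + s)%N by rewrite sA /C1 /=; lia.
  have X1 : (A * s.+1 <= A * (d * (s %/ d) + d))%N by rewrite leq_mul2l dB2 orbT.
  rewrite mulnS mulnDr mulnC in X1; rewrite E1 in AdC.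
  have BC : (B <= s + C1)%N by rewrite leq_add2r.
  lia.
rewrite -/m /stepC -/C1.
have dq : (d <= q)%N by rewrite (leq_trans dN) // leq_pred.
have dA : (d * A <= q * s)%N by rewrite leq_mul // sA leq_pmull // expn_gt0 ltnW.
have dm : (d * (s * m) <= q * (s * m))%N by rewrite leq_mul2r dq orbT.
have dC : (d * C1 <= q * C1)%N by rewrite leq_mul2r dq orbT.
have X2 : (s * (d * (s %/ d) + d * C1) <= s * (s + q * C1))%N by rewrite leq_mul2l leq_add ?orbT.
have -> : (d * (A + s * m + s * B) = d * A + d * (s * m) + s * (d * (s %/ d) + d * C1))%N.
  by rewrite /B !mulnDr [(d * (s * (s %/ d)))%N]mulnCA [(d * (s * C1))%N]mulnCA.
have -> : (s * (q * (1 + m + C1)) = q * s + q * (s * m) + s * (q * C1))%N.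
  by rewrite !mulnDr muln1 [(s * q)%N]mulnC [(s * (q * m))%N]mulnCA.
rewrite [X in (_ <= X)%N]mulnDr in X2; move: dA dm X2.
move: (d * A)%N (q * s)%N (d * (s * m))%N (q * (s * m))%N.
move: (s * (_ + _))%N (s * s)%N (s * (q * _))%N.
by move=> *; lia.
Qed.

(** * Finite extensions of the base field *)

Lemma pnat_card_finField (K : finFieldType) : [pchar K].-nat #|K|.
Proof.
have [p pr_p pK] := finPcharP K.
have := abelian.abelem_pgroup (abelian.fin_ring_pchar_abelem pK).
rewrite /pgroup.pgroup cardsT; apply: sub_in_pnat => r _ /eqP -> //.
Qed.

(** Over a finite field there are finitely many polynomials of bounded size, so a splitting field of
    their product serves them all and is still a finite type. *)
Lemma finField_splitting_ext (K : finFieldType) m :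
  exists (E : finFieldType) (j : {rmorphism K -> E}),
  forall G : {poly K}, G != 0 -> (size G <= m)%N ->
    exists rs, map_poly j G %= \prod_(x <- rs) ('X - x%:P).
Proof.
pose P := \prod_(G : {poly_m K} | (G : {poly K}) != 0) (G : {poly K}).
have P0 : P != 0 by apply/prodf_neq0.
have [L [rs PL _]] := FinSplittingFieldFor P0.
exists (FinFieldExtType L), (in_alg L) => G G0 szG.
have : map_poly (in_alg L) G %| \prod_(x <- rs) ('X - x%:P).
  rewrite -(eqp_dvdr _ PL) dvdp_map /P (bigD1 (npolyp m G)) /= ?npolypK //.
  exact: dvdp_mulr.
by case/dvdp_prod_XsubC=> msk eqG; exists (mask msk rs).
Qed.

Section Fixed.
Variables (K E : finFieldType) (j : {rmorphism K -> E}).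
Notation q := #|K|.

Lemma pnat_card_ext : [pchar E].-nat q.
Proof.
by apply: sub_in_pnat (pnat_card_finField K) => p _; rewrite (fmorph_pchar j).
Qed.

(** E may be larger than the extension of degree n. The fixed points are the roots of X^(q^n) - X,
    which are simple since its derivative is -1. *)
Lemma card_fixed n (rs : seq E) : (0 < n)%N ->
  map_poly j ('X^(q ^ n) - 'X) %= \prod_(x <- rs) ('X - x%:P) ->
  #|[set x : E | x ^+ (q ^ n)%N == x]| = (q ^ n)%N.
Proof.
move=> n0; rewrite rmorphB /= map_polyXn map_polyX; set s := (q ^ n)%N => eq_rs.
have s1 : (1 < s)%N by rewrite /s -(exp1n n) ltn_exp2r // finNzRing_gt1.
have szX : size ('X^s - 'X : {poly E}) = s.+1.
  by rewrite size_polyDl ?size_polyXn // size_polyN size_polyX.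
have urs : uniq rs.
  rewrite -separable_prod_XsubC -(eqp_separable eq_rs) unlock.
  rewrite derivB derivXn derivX.
  have -> : 'X^(s.-1) *+ s = 0 :> {poly E}.
    rewrite -mulr_natr; apply/eqP; rewrite mulf_eq0; apply/orP; right.
    have char_s : [pchar {poly E}].-nat s by rewrite pnat_pchar_poly // pnatX pnat_card_ext.
    rewrite -(dvdn_pcharf (p := pdiv s)) ?pdiv_dvd //.
    by apply: (pnatPpi char_s); rewrite pi_pdiv.
  by rewrite sub0r -[- 1]scaleN1r coprimepZr ?coprimep1 // oppr_eq0 oner_eq0.
have szrs : size rs = s.
  by apply/eqP; rewrite -eqSS -(size_prod_XsubC rs id) -(eqp_size eq_rs) szX.
rewrite -[RHS]szrs -(card_uniqP urs) cardsE; apply: eq_card => x.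
by rewrite -[RHS]root_prod_XsubC -(eqp_root eq_rs) rootE !hornerE subr_eq0.
Qed.

Lemma fixed_rmorphP (y : E) : y ^+ q = y <-> exists x, y = j x.
Proof.
split; last by case=> x ->; rewrite -rmorphXn expf_card.
move=> yq.
have : root (map_poly j ('X^q - 'X)) y.
  by rewrite rmorphB /= map_polyXn map_polyX rootE !hornerE yq subrr.
rewrite finField_genPoly rmorph_prod /=.
under eq_bigr do rewrite map_polyXsubC.
rewrite -(big_map j xpredT (fun y => 'X - y%:P)) /=.
by rewrite root_prod_XsubC => /mapP[x _ ->]; exists x.
Qed.
End Fixed.

Definition frob (K E : finFieldType) (j : {rmorphism K -> E}) (x : E) := x ^+ #|K|.
Arguments frob : simpl never.

Lemma eq_nat_leq m n : (forall k, (k <= m)%N = (k <= n)%N) -> m = n.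
Proof. by move=> H; apply/eqP; rewrite eqn_leq -H leqnn H leqnn. Qed.

Lemma eq_mup (F : fieldType) (p q : {poly F}) x y : p != 0 -> q != 0 ->
  (forall k, (('X - x%:P) ^+ k %| p) = (('X - y%:P) ^+ k %| q)) -> mup x p = mup y q.
Proof. by move=> p0 q0 dv; apply: eq_nat_leq => k; rewrite !mup_geq. Qed.

Section Frob.
Variables (K E : finFieldType) (j : {rmorphism K -> E}).

Lemma frob_is_zmod_morphism : zmod_morphism (frob j).
Proof.
move=> x y; rewrite /frob exprDn_pchar ?exprNn_pchar //; exact: pnat_card_ext j.
Qed.
Lemma frob_is_monoid_morphism : monoid_morphism (frob j).
Proof. by split=> [|x y]; rewrite /frob ?expr1n // exprMn. Qed.
HB.instance Definition _ := GRing.isZmodMorphism.Build E E (frob j) frob_is_zmod_morphism.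
HB.instance Definition _ := GRing.isMonoidMorphism.Build E E (frob j) frob_is_monoid_morphism.

Lemma iter_frob n x : iter n (frob j) x = x ^+ (#|K| ^ n)%N.
Proof.
elim: n => [|n IH]; first by rewrite expn0 expr1.
by rewrite iterS IH /frob -exprM expnSr.
Qed.

Lemma frob_map (G : {poly K}) : map_poly (frob j) (map_poly j G) = map_poly j G.
Proof.
by rewrite -map_poly_comp; apply: eq_map_poly => x /=; rewrite /frob -rmorphXn expf_card.
Qed.

Lemma horner_frob (G : {poly K}) x :
  (map_poly j G).[frob j x] = frob j (map_poly j G).[x].
Proof. by rewrite -{1}frob_map horner_map. Qed.

Lemma frob_inj : injective (frob j).
Proof. exact: fmorph_inj. Qed.

Lemma frob_descent (p : {poly E}) :
  map_poly (frob j) p = p -> exists G : {poly K}, map_poly j G = p.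
Proof.
move=> fp; have /fin_all_exists[g gE] : forall i : 'I_(size p), exists a, p`_i = j a.
  by move=> i; apply/fixed_rmorphP; move/(congr1 (coefp i)): fp; rewrite /= coef_map.
exists (\poly_(i < size p) (if insub i is Some i' then g i' else 0)).
apply/polyP=> i; rewrite coef_map coef_poly.
case: insubP => [i' lt def_i|]; last first.
  by rewrite -leqNgt => le; rewrite ltnNge le /= rmorph0 nth_default.
by rewrite lt /= -gE def_i.
Qed.

(** The product runs over n iterates and not over the orbit: for x of degree dl dividing n it is the
    (n / dl)-th power of the minimal polynomial, the characteristic polynomial of x in the extension
    of degree n. *)
Definition conj_polyE n (x : E) : {poly E} := \prod_(i < n) ('X - (iter i (frob j) x)%:P).

Lemma cpE_add a b x : conj_polyE (a + b) x = conj_polyE a x * conj_polyE b (iter a (frob j) x).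
Proof.
rewrite /conj_polyE big_split_ord; congr (_ * _); apply: eq_bigr => i _.
by rewrite /= addnC iterD.
Qed.

Lemma frob_cpE n x : iter n (frob j) x = x -> map_poly (frob j) (conj_polyE n x) = conj_polyE n x.
Proof.
case: n => [|n] xn; first by rewrite /conj_polyE !big_ord0 rmorph1.
rewrite /conj_polyE rmorph_prod big_ord_recr big_ord_recl mulrC /=.
rewrite map_polyXsubC -iterS xn; congr (_ * _).
by apply: eq_bigr => i _; rewrite map_polyXsubC.
Qed.

Lemma monic_cpE n x : conj_polyE n x \is monic.
Proof. exact: monic_prod_XsubC. Qed.

Lemma size_cpE n x : size (conj_polyE n x) = n.+1.
Proof. by rewrite /conj_polyE size_prod_XsubC -[index_enum _]enumT size_enum_ord. Qed.

(* [conj_polyE n x] descended to K; meaningful when x is fixed by the n-th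
   iterate of Frobenius. *)
Definition conj_poly n (x : E) : {poly K} :=
  map_poly (fun y => odflt 0 [pick a | j a == y]) (conj_polyE n x).

Lemma map_cp n x : iter n (frob j) x = x -> map_poly j (conj_poly n x) = conj_polyE n x.
Proof.
move=> xn; have [G EG] := frob_descent (frob_cpE xn).
suff -> : conj_poly n x = G by [].
rewrite /conj_poly -EG; apply/polyP=> i; rewrite coef_map_id0 ?coef_map.
  case: pickP => [a /eqP /fmorph_inj // | /(_ G`_i)]; by rewrite eqxx.
case: pickP => [a | /(_ 0)]; last by rewrite rmorph0 eqxx.
by rewrite fmorph_eq0 => /eqP.
Qed.

Lemma mup_frob (G : {poly K}) x : G != 0 ->
  mup (frob j x) (map_poly j G) = mup x (map_poly j G).
Proof.
move=> G0; have G0' : map_poly j G != 0 by rewrite map_poly_eq0.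
apply: eq_mup => // k.
by rewrite -[RHS](dvdp_map (frob j)) frob_map [in RHS]rmorphXn /= map_polyXsubC.
Qed.

Lemma prod_XsubCX_dvdp (p : {poly E}) (s : seq E) k :
  uniq s -> {in s, forall y, ('X - y%:P) ^+ k %| p} ->
  (\prod_(y <- s) ('X - y%:P)) ^+ k %| p.
Proof.
elim: s => [|y s IH] /=; first by rewrite big_nil expr1n dvd1p.
case/andP=> ys us sp; rewrite big_cons exprMn Gauss_dvdp.
  by rewrite sp ?mem_head // IH // => z zs; apply: sp; rewrite inE zs orbT.
by rewrite coprimep_expl // coprimep_expr // coprimep_sym coprimep_XsubC root_prod_XsubC.
Qed.

(* x is a zero of G of multiplicity mu iff exactly mu of the powers of its
   minimal polynomial divide G, and these powers are the [conj_poly n x]. *)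
Lemma count_cp (G : {poly K}) x n : G != 0 -> (size G <= n.+1)%N ->
  (\sum_(i < n) ((iter i.+1 (frob j) x == x) && (conj_poly i.+1 x %| G)%R)
   = mup x (map_poly j G))%N.
Proof.
move=> G0 szG; have G0' : map_poly j G != 0 by rewrite map_poly_eq0.
set mu := mup x _.
set dl := order (frob j) x.
have dl0 : (0 < dl)%N by apply: order_gt0.
have xdl : iter dl (frob j) x = x by apply: iter_order; apply: frob_inj.
have iterM k : iter (k * dl) (frob j) x = x.
  by elim: k => [|k IH] //; rewrite mulSn iterD IH.
have fixE i : (iter i (frob j) x == x) = (dl %| i)%N.
  rewrite {1}(divn_eq i dl) addnC iterD iterM.
  have findr r : (r < dl)%N -> findex (frob j) x (iter r (frob j) x) = r.
    exact: findex_iter.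
  apply/eqP/idP => [xr|/eqP ->] //; rewrite /dvdn.
  by rewrite -(findr _ (ltn_pmod i dl0)) xr (findr 0%N).
have cpM k : conj_polyE (k * dl) x = conj_polyE dl x ^+ k.
  elim: k => [|k IH]; first by rewrite /conj_polyE big_ord0.
  by rewrite mulSn cpE_add xdl IH exprS.
have cpdl : conj_polyE dl x = \prod_(y <- orbit (frob j) x) ('X - y%:P).
  rewrite /orbit -/dl (big_nth x) size_traject big_mkord.
  by apply: eq_bigr => i _; rewrite nth_traject.
have dvE k : (conj_poly (k * dl) x %| G) = (k <= mu)%N.
  rewrite -(dvdp_map j) map_cp // cpM mup_geq // cpdl; apply/idP/idP.
    apply: dvdp_trans; apply: dvdp_exp2r.
    by rewrite dvdp_XsubCl root_prod_XsubC -fconnect_orbit.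
  move=> dv; apply: prod_XsubCX_dvdp; first exact: orbit_uniq.
  move=> y; rewrite -fconnect_orbit => /iter_findex <-.
  rewrite -mup_geq //; elim: (findex _ _ _) => [|i IH]; first by rewrite mup_geq.
  by rewrite iterS mup_frob.
(* Cutting the sum at n loses nothing: the mu-th power of the minimal polynomial divides G. It
   remains to count the multiples of dl up to mu dl. *)
have le_mu : (mu * dl <= n)%N.
  have : conj_polyE (mu * dl) x %| map_poly j G by rewrite -map_cp // dvdp_map dvE.
  move/(dvdp_leq G0'); rewrite size_cpE size_map_poly => /leq_trans /(_ szG).
  by rewrite ltnS.
transitivity (\sum_(i < n | (i < mu * dl)%N) (dl %| i.+1))%N.
  rewrite [RHS]big_mkcond; apply: eq_bigr => i _; rewrite fixE.
  case: (boolP (dl %| i.+1)%N) => [/dvdnP[k ->]|_] /=; last by case: ifP.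
  by rewrite dvE leq_pmul2r // dvdn_mull //; case: (k <= mu)%N.
rewrite -(big_ord_widen n (fun i => nat_of_bool (dl %| i.+1)%N)) //.
by rewrite -[RHS](mulnK _ dl0) divn_count_dvd big_add1 big_mkord.
Qed.
End Frob.

(** * The recursion between coefficients and power sums *)

Section MonicPoly.
Variable K : fieldType.

Definition mon n (v : 'rV[K]_n) : {poly K} := 'X^n + rVpoly v.
Definition unmon n (G : {poly K}) : 'rV[K]_n := poly_rV (G - 'X^n).

Lemma size_mon n (v : 'rV[K]_n) : size (mon v) = n.+1.
Proof. by rewrite /mon size_polyDl size_polyXn // ltnS size_poly. Qed.

Lemma monic_mon n (v : 'rV[K]_n) : mon v \is monic.
Proof. by rewrite monicE lead_coefDl ?lead_coefXn // size_polyXn ltnS size_poly. Qed.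

Lemma monK n : cancel (@mon n) (unmon n).
Proof. by move=> v; rewrite /unmon /mon addrC addKr rVpolyK. Qed.

Lemma unmonK n (G : {poly K}) : G \is monic -> size G = n.+1 -> mon (unmon n G) = G.
Proof.
move=> monG szG; rewrite /mon poly_rV_K; first by rewrite addrC subrK.
apply/leq_sizeP=> i; rewrite leq_eqVlt coefB coefXn => /orP[/eqP <-|lt].
  by rewrite eqxx -[n]/(n.+1.-1) -szG -lead_coefE (monicP monG) subrr.
by rewrite gtn_eqF // nth_default ?subrr // szG.
Qed.
End MonicPoly.

Section Recursion.
Variables (K E : finFieldType) (j : {rmorphism K -> E}) (lam : {poly K} -> algC).
Hypothesis lamM : forall G H : {poly K}, lam (G * H) = lam G * lam H.

Definition monic_sum n := \sum_(v : 'rV[K]_n) lam (mon v).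
(** For multiplicative lam the summand is lam(P)^(i / deg P), P being the minimal polynomial of x.
    When E contains the extension of degree i, this is the i-th coefficient of X L'/L for L = sum_n
    c_n X^n, by its Euler product. *)
Definition power_sum i := \sum_(x : E | iter i (frob j) x == x) lam (conj_poly j i x).

Lemma csum_dvd (P : {poly K}) n i : P \is monic -> size P = i.+1 -> (i <= n)%N ->
  \sum_(v : 'rV[K]_n | P %| mon v) lam (mon v) = lam P * monic_sum (n - i).
Proof.
move=> monP szP le_in; have P0 := monic_neq0 monP.
have PM (w : 'rV_(n - i)) : mon (unmon n (P * mon w)) = P * mon w.
  rewrite unmonK ?monicMl ?monic_mon //.
  by rewrite size_monicM ?monic_neq0 ?monic_mon // szP size_mon addnS /= addSn subnKC.
rewrite (reindex_onto (fun w : 'rV_(n - i) => unmon n (P * mon w))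
          (fun v => unmon (n - i) (mon v %/ P))) /=; last first.
  move=> v dv; apply: (can_inj (@monK _ _)); rewrite PM.
  have mv : mon v %/ P \is monic by rewrite -(monicMr _ monP) divpK ?monic_mon.
  by rewrite unmonK ?divpKC // 1?mulrC ?divpK // size_divp // size_mon szP subSn.
rewrite /monic_sum mulr_sumr; apply: eq_big => [w|w _]; rewrite PM ?lamM //.
by rewrite dvdp_mulr //= mulKp // monK eqxx.
Qed.

Lemma sum_count_mem (rs : seq E) : (\sum_(x : E) count_mem x rs = size rs)%N.
Proof.
elim: rs => [|y rs IH] /=; first by rewrite big1.
rewrite big_split IH /= -add1n; congr (_ + _)%N.
by rewrite (bigD1 y) //= eqxx big1 // => x /negPf; rewrite eq_sym => ->.
Qed.

(* n c_n counts each monic G of degree n once per zero, with multiplicity. *)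
Lemma csum_rec n :
  (forall G : {poly K}, G \is monic -> size G = n.+1 ->
     exists rs, map_poly j G %= \prod_(x <- rs) ('X - x%:P)) ->
  n%:R * monic_sum n = \sum_(i < n) power_sum i.+1 * monic_sum (n - i.+1).
Proof.
move=> splits.
have E0 (v : 'rV[K]_n) : n%:R = \sum_(i < n) \sum_(x : E | iter i.+1 (frob j) x == x)
    (conj_poly j i.+1 x %| mon v)%R%:R :> algC.
  have [rs eq_rs] := splits _ (monic_mon v) (size_mon v).
  have {}eq_rs : map_poly j (mon v) = \prod_(x <- rs) ('X - x%:P).
    by apply/eqP; rewrite -eqp_monic ?map_monic ?monic_mon ?monic_prod_XsubC.
  have szrs : size rs = n.
    apply/eqP; rewrite -eqSS -(size_prod_XsubC rs id) -eq_rs.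
    by rewrite size_map_poly size_mon.
  rewrite -[in LHS]szrs -sum_count_mem natr_sum.
  under [RHS]eq_bigr do rewrite big_mkcond.
  rewrite exchange_big; apply: eq_bigr => x _.
  rewrite -mu_prod_XsubC -eq_rs -(@count_cp _ _ _ _ _ n) ?monic_neq0 ?monic_mon ?size_mon //.
  by rewrite natr_sum; apply: eq_bigr => i _; case: ifP.
rewrite /monic_sum mulr_sumr.
under eq_bigr => v _ do rewrite (E0 v) mulr_suml.
rewrite exchange_big; apply: eq_bigr => i _.
under eq_bigr do rewrite mulr_suml.
rewrite exchange_big /power_sum mulr_suml; apply: eq_bigr => x /eqP xi.
have szcp : size (conj_poly j i.+1 x) = i.+2.
  by rewrite -(size_map_poly j) map_cp // size_cpE.
have moncp : conj_poly j i.+1 x \is monic.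
  by rewrite -(map_monic j) map_cp // monic_cpE.
rewrite -(csum_dvd moncp szcp) // [RHS]big_mkcond; apply: eq_bigr => v _.
by case: ifP; rewrite ?mul1r ?mul0r.
Qed.
End Recursion.

(** * Newton's identities and the size of the inverse roots *)

(** Coefficientwise form of X L' = - (sum_i p_i X^i) L, where p_i is the i-th power sum of ws; the
    factors are adjoined one at a time. *)
Lemma newton_prod (R : comNzRingType) (ws : seq R) n :
  let L := \prod_(w <- ws) (1 - w *: 'X) in
  n%:R * L`_n = - \sum_(i < n) (\sum_(w <- ws) w ^+ i.+1) * L`_(n - i.+1).
Proof.
move=> /=; apply/eqP; rewrite -addr_eq0; apply/eqP; move: n.
elim: ws => [|w ws IH] n.
  rewrite !big_nil coefC big1 ?addr0 => [|i _]; last by rewrite big_nil mul0r.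
  by case: n => [|n]; rewrite ?mul0r ?mulr0.
case: n => [|m]; first by rewrite big_ord0 mul0r addr0.
rewrite big_cons; set q := \prod_(w <- ws) _ in IH *.
pose q' := (1 - w *: 'X) * q.
have q'0 : q'`_0 = q`_0.
  by rewrite /q' mulrBl mul1r -scalerAl coefB coefZ coefXM mulr0 subr0.
have q'S i : q'`_i.+1 = q`_i.+1 - w * q`_i.
  by rewrite /q' mulrBl mul1r -scalerAl coefB coefZ coefXM.
(* The series w / (1 - w X) multiplied by q' = (1 - w X) q gives back w q. *)
have tel k : \sum_(i < k.+1) w ^+ i.+1 * q'`_(k - i) = w * q`_k.
  elim: k => [|k IHk]; first by rewrite big_ord1 subnn expr1 q'0.
  rewrite big_ord_recl subn0 expr1 q'S.
  under eq_bigr => i _ do rewrite lift0 subSS exprS -mulrA.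
  by rewrite -mulr_sumr IHk; ring.
have sh : \sum_(i < m.+1) (\sum_(w <- ws) w ^+ i.+1) * q'`_(m - i) =
   \sum_(i < m.+1) (\sum_(w <- ws) w ^+ i.+1) * q`_(m - i)
   - w * \sum_(i < m) (\sum_(w <- ws) w ^+ i.+1) * q`_(m - i.+1).
  rewrite !big_ord_recr /= subnn q'0 mulr_sumr addrAC; congr (_ + _).
  rewrite -sumrB; apply: eq_bigr => i _.
  by rewrite -(subnSK (ltn_ord i)) q'S; ring.
rewrite -/q' q'S.
under eq_bigr => i _ do rewrite big_cons subSS mulrDl.
rewrite big_split /= tel sh.
have := IH m.+1; have := IH m; rewrite /=.
under [X in _ -> _ + X = _ -> _]eq_bigr => i _ do rewrite subSS.
move: (\sum_(i < m) _) (\sum_(i < m.+1) _) => a b Ea Eb.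
have -> : a = - (m%:R * q`_m) by apply/eqP; rewrite -addr_eq0 addrC Ea.
have -> : b = - (m.+1%:R * q`_m.+1) by apply/eqP; rewrite -addr_eq0 addrC Eb.
by rewrite -[in m.+1%:R]add1n natrD; ring.
Qed.

(** The list precedes S and n, and the recursion is asked for only up to n: power sums of different
    levels are computed in different fields, each reliable up to its own level. *)
Lemma newton_roots (c : nat -> algC) D : c 0%N = 1 -> (forall n, (D < n)%N -> c n = 0) ->
  exists2 ws : seq algC, (size ws <= D)%N &
  forall (S : nat -> algC) n, (0 < n)%N ->
   (forall m, (m <= n)%N -> m%:R * c m = \sum_(i < m) S i.+1 * c (m - i.+1)%N) ->
   S n = - \sum_(w <- ws) w ^+ n.
Proof.
move=> c0 cD; pose L := \poly_(i < D.+1) c i.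
have Lc n : L`_n = c n.
  by rewrite coef_poly ltnS; case: leqP => // /cD ->.
have [zs EL] := closed_field_poly_normal L.
have L0 : L.[0] = 1 by rewrite horner_coef0 Lc.
have Ln0 : L != 0 by apply: contra_eqN L0 => /eqP ->; rewrite horner0 eq_sym oner_eq0.
have lc0 : lead_coef L != 0 by rewrite lead_coef_eq0.
have zs0 z : z \in zs -> z != 0.
  move=> zz; apply: contra_eqN L0 => /eqP z0; rewrite -z0 EL hornerZ.
  suff /rootP -> : root (\prod_(z <- zs) ('X - z%:P)) z by rewrite mulr0 eq_sym oner_eq0.
  by rewrite root_prod_XsubC.
have EL' : L = \prod_(w <- [seq z^-1 | z <- zs]) (1 - w *: 'X).
  have E1 : \prod_(z <- zs) ('X - z%:P) =
     (\prod_(z <- zs) - z) *: \prod_(w <- [seq z^-1 | z <- zs]) (1 - w *: 'X).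
    rewrite big_map -scaler_prod; apply: eq_big_seq => z /zs0 z0.
    by rewrite scalerBr scalerA mulNr divff // scaleN1r opprK alg_polyC polyCN addrC.
  rewrite EL E1 scalerA -[RHS]scale1r; congr (_ *: _).
  rewrite -[RHS]L0 [in RHS]EL hornerZ horner_prod; congr (_ * _).
  by apply: eq_bigr => z _; rewrite hornerXsubC sub0r.
exists [seq z^-1 | z <- zs].
  rewrite size_map -ltnS -(size_prod_XsubC zs id) -(size_scale _ lc0) -EL.
  exact: size_poly.
move=> S; elim/ltn_ind => -[//|n] IH _ rec.
have := newton_prod [seq z^-1 | z <- zs] n.+1; rewrite /= -EL' Lc rec //.
rewrite !big_ord_recr /= subnn !Lc c0 !mulr1 opprD => E.
apply: (addrI (\sum_(i < n) S i.+1 * c (n.+1 - i.+1)%N)).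
rewrite E; congr (_ + _); rewrite -sumrN; apply: eq_bigr => i _.
by rewrite Lc -mulNr -IH ?ltnS ?ltn_ord // => m le; apply: rec; apply: leq_trans le (ltnW _); rewrite ltnS.
Qed.

Lemma bernoulli (R : numDomainType) (e : R) n : 0 <= e -> 1 + e *+ n <= (1 + e) ^+ n.
Proof.
move=> e0; elim: n => [|n IH]; first by rewrite mulr0n addr0 expr0.
rewrite exprS; apply: le_trans (ler_wpM2l _ IH); last by rewrite addr_ge0 ?ler01.
have -> : (1 + e) * (1 + e *+ n) = 1 + e *+ n.+1 + e * (e *+ n) by rewrite mulrS; ring.
by rewrite lerDl mulr_ge0 // mulrn_wge0.
Qed.

(* Applying the polynomial that kills all entries but z to the sequence of power
   sums isolates z^t. *)
Lemma bounded_power_sums (zs : seq algC) (C : algC) t0 :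
  (forall t, (t0 <= t)%N -> `|\sum_(z <- zs) z ^+ t| <= C) ->
  {in zs, forall z, `|z| <= 1}.
Proof.
move=> bd z zz; pose u := \prod_(y <- undup zs | y != z) ('X - y%:P).
have uz : u.[z] != 0.
  rewrite horner_prod prodf_seq_neq0; apply/allP => y _; apply/implyP => yz.
  by rewrite hornerXsubC subr_eq0 eq_sym.
have uy y : y \in zs -> y != z -> u.[y] = 0.
  move=> yzs yz; apply/eqP; rewrite horner_prod prodf_seq_eq0.
  by apply/hasP; exists y; rewrite ?mem_undup //= yz hornerXsubC subrr eqxx.
have cz0 : (0 < count_mem z zs)%N by rewrite -has_count; apply/hasP; exists z => /=.
have key t : \sum_(i < size u) u`_i * \sum_(y <- zs) y ^+ (t + i) =
    (count_mem z zs)%:R * (z ^+ t * u.[z]).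
  under eq_bigr do rewrite mulr_sumr.
  rewrite exchange_big /= (eq_big_seq (fun y => if y == z then z ^+ t * u.[z] else 0)).
    by rewrite -big_mkcond big_const_seq iter_addr_0 mulr_natl.
  move=> y yzs; transitivity (y ^+ t * u.[y]).
    rewrite horner_coef mulr_sumr; apply: eq_bigr => i _.
    by rewrite exprD mulrCA.
  by case: eqVneq => [->|/(uy _ yzs) ->] //; rewrite mulr0.
pose M := (\sum_(i < size u) `|u`_i| * C) / (count_mem z zs)%:R / `|u.[z]|.
have le_M t : (t0 <= t)%N -> `|z| ^+ t <= M.
  move=> le_t; rewrite /M ler_pdivlMr ?normr_gt0 // ler_pdivlMr ?ltr0n //.
  rewrite -normrX -normrM -[X in _ * X]normr_nat -normrM mulrC -key.
  apply: le_trans (ler_norm_sum _ _ _) _; apply: ler_sum => i _.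
  by rewrite normrM ler_wpM2l // bd // (leq_trans le_t) // leq_addr.
rewrite real_leNgt ?normr_real ?real1 //; apply/negP => z1.
have e0 : 0 < `|z| - 1 by rewrite subr_gt0.
have M0 : 0 <= M by apply: le_trans (le_M _ (leqnn t0)); rewrite exprn_ge0.
have Me0 : 0 <= M / (`|z| - 1) by rewrite divr_ge0 // ltW.
pose t := (t0 + Num.bound (M / (`|z| - 1)))%N.
have := le_M t (leq_addr _ _); apply/negP; rewrite -real_ltNge ?ger0_real ?exprn_ge0 //.
apply: lt_le_trans (_ : 1 + (`|z| - 1) *+ t <= _); last first.
  by apply: le_trans (bernoulli _ (ltW e0)) _; rewrite addrC subrK.
have : M < (`|z| - 1) *+ t.
  rewrite -mulr_natl -ltr_pdivrMr //; apply: lt_le_trans (archi_boundP Me0) _.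
  by rewrite ler_nat leq_addl.
by move=> ltM; rewrite (lt_trans ltM) // ltrDr ltr01.
Qed.

(** * Character sums over the extensions *)

Section CharSum.
Variables (K E : finFieldType) (j : {rmorphism K -> E}) (w : K -> algC).
Hypothesis wP : faithful_char w.
Notation q := #|K|.
Variables (hK : {poly K}) (t k d : nat).
Notation h := (map_poly j hK).
Notation s := (q ^ t)%N.
Hypotheses (hK0 : hK != 0) (def_s : s = (q.-1 * k).+1) (t1 : (1 < t)%N).
Hypothesis t_big : ((q ^ 2 * (size h).+1).+1 < q ^ (t - 2))%N.
Hypothesis hd : exists v, hK ^+ d = v ^+ q.-1.
Hypothesis Hd : forall i, (forall r, q.-1 %| i * mup r h)%N -> (d %| i)%N.
Hypotheses (d1 : (1 < d)%N) (dq : (d %| q.-1)%N).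
Hypothesis fixedE : #|[set x : E | x ^+ (s * s)%N == x]| = (s * s)%N.

Let q1 : (1 < q)%N := finNzRing_gt1 K.
Let N0 : (0 < q.-1)%N. Proof. by rewrite -ltnS prednK // ltnW. Qed.
Let s1 : (1 < s)%N.
Proof. by rewrite -(exp1n t) ltn_exp2r // ltnW. Qed.
Let k0 : (0 < k)%N.
Proof. by rewrite lt0n; apply: contraTneq s1 => kz; rewrite def_s kz muln0. Qed.

Lemma horner_fixed (G : {poly K}) x : x ^+ (s * s)%N = x ->
  (map_poly j G).[x] ^+ (s * s)%N = (map_poly j G).[x].
Proof.
rewrite -expnD -!(iter_frob j) => fx; rewrite -{2}fx.
by elim: (t + t)%N => // n IH; rewrite !iterS horner_frob IH.
Qed.

Lemma fixed_expf1 (y : E) : y != 0 -> y ^+ (s * s)%N = y -> y ^+ (q.-1 * (k * s.+1)) = 1.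
Proof.
move=> y0 fy; apply: (mulfI y0); rewrite mulr1 -exprS -{2}fy; congr (_ ^+ _).
by rewrite mulnA [in RHS]def_s; lia.
Qed.

(** The sum is regrouped by the norm of h(x), a d-th root of unity z, into sum_z N_z w(z). Each d
    N_z is at most B, the N_z add up to at least s^2 minus the size of h, and sum_z w(z) = 0 allows
    the common value B to be subtracted. *)
Lemma char_sum_bound (chi : E -> algC) :
  (forall x y, x ^+ (s * s)%N = x -> j y = h.[x] ^+ (k * s.+1) -> chi x = w y) ->
  `|\sum_(x : E | x ^+ (s * s)%N == x) chi x| <= (s * (stepC q (size h) + size h))%:R.
Proof.
move=> chiE; have h0 : h != 0 by rewrite map_poly_eq0.
have szh_s : (size h < s)%N.
  have : (q ^ (t - 2) <= s)%N by rewrite leq_exp2l // leq_subr.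
  move: t_big; have : (0 < q ^ 2)%N by rewrite expn_gt0 ltnW.
  move: (size h) (q ^ 2)%N (q ^ (t - 2))%N s; nia.
have ks0 : (0 < k * s.+1)%N by rewrite muln_gt0 k0.
have /fin_all_exists[v vE] : forall x : E, exists y,
    (x ^+ (s * s)%N == x) ==> (j y == h.[x] ^+ (k * s.+1)).
  move=> x; case: eqP => [fx|_]; last by exists 0.
  suff : exists y, h.[x] ^+ (k * s.+1) = j y by case=> y ->; exists y; rewrite eqxx.
  have pw (a : E) : a ^+ q = a * a ^+ q.-1 by rewrite -exprS prednK // ltnW.
  apply/fixed_rmorphP; rewrite pw -exprM [X in _ * _ ^+ X]mulnC.
  have [->|hx0] := eqVneq h.[x] 0; first by rewrite expr0n gtn_eqF // mul0r.
  by rewrite fixed_expf1 ?mulr1 // horner_fixed.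
have {}vE x : x ^+ (s * s)%N = x -> j (v x) = h.[x] ^+ (k * s.+1).
  by move=> fx; move/implyP: (vE x) => /(_ (introT eqP fx)) /eqP.
pose P (x : E) := (x ^+ (s * s)%N == x) && (h.[x] != 0).
have sumP : \sum_(x : E | x ^+ (s * s)%N == x) chi x = \sum_(x | P x) w (v x).
  rewrite (bigID (fun x => h.[x] == 0)) /= big1 ?add0r.
    by apply: eq_bigr => x /andP[/eqP fx _]; apply: chiE => //; apply: vE.
  move=> x /andP[/eqP fx /eqP hx]; rewrite (chiE x 0) ?fchar0 //.
  by rewrite hx rmorph0 expr0n gtn_eqF.
(* h^d is a (q-1)-th power, and so is h(x)^d in the field with s^2 elements; its norm to K is
   therefore 1. *)
have vd x : P x -> v x ^+ d == 1.
  case/andP=> /eqP fx hx; have [u hu] := hd.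
  rewrite -(fmorph_eq1 j) rmorphXn vE // -exprM mulnC exprM.
  have E0 : h.[x] ^+ d = (map_poly j u).[x] ^+ q.-1.
    by rewrite -!horner_exp -!rmorphXn hu.
  rewrite E0 -exprM fixed_expf1 ?horner_fixed //.
  by apply: contraNneq hx => ux; move/eqP: E0; rewrite ux expr0n gtn_eqF // expf_eq0 => /andP[].
rewrite sumP (partition_big v (fun z => z ^+ d == 1)) //=.
pose Nz z := #|norm_fiber h s k (j z)|.
have cardP z : #|[pred x | P x && (v x == z)]| = Nz z.
  apply: eq_card => x; rewrite [RHS]inE [LHS]inE /= /P.
  case: eqP => //= fx; case: (h.[x] != 0) => //=.
  by rewrite -vE // (inj_eq (fmorph_inj j)).
have fibE z : \sum_(x | P x && (v x == z)) w (v x) = (Nz z)%:R * w z.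
  rewrite (eq_bigr (fun=> w z)) => [|x /andP[_ /eqP -> //]].
  by rewrite sumr_const mulr_natl cardP.
under eq_bigr do rewrite fibE.
have [sum0 cardU] := sum_fchar_unity wP d1 dq.
set m := size h in szh_s *; pose B := (s * s + s * stepC q m)%N.
have NzB z : (d * Nz z <= B)%N.
  have [x0 fx0 hx0] : exists2 x0, x0 ^+ (s * s)%N = x0 & h.[x0] != 0.
    have : (size h <= #|[set x : E | x ^+ (s * s)%N == x]|)%N.
      by rewrite fixedE -/m ltnW // (leq_trans szh_s) // leq_pmulr // ltnW.
    case: (pickP [pred x : E | (x ^+ (s * s)%N == x) && (h.[x] != 0)]) => [x|none].
      by case/andP=> /eqP; exists x.
    rewrite leqNgt cardE max_poly_roots ?enum_uniq //; apply/allP=> x.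
    by rewrite mem_enum inE => fx; move: (none x); rewrite /= fx => /negbT/negPn.
  rewrite /Nz /B /m. apply: (@stepanov_bound E h x0 q t k d (j z) q1 _ def_s hx0) => //.
    by rewrite pnatX pnat_card_ext.
  by rewrite ltnW //= dvdn_leq.
have sumNz : (s * s <= \sum_(z : K | (z ^+ d == 1)%R) Nz z + m)%N.
  under eq_bigr do rewrite -cardP -sum1_card.
  rewrite -(partition_big v (fun z => z ^+ d == 1)) //= -fixedE -sum1_card.
  rewrite (bigID (fun x => h.[x] == 0)) /= addnC leq_add //.
    by apply: eq_leq; apply: eq_bigl => x; rewrite inE.
  rewrite sum1_card cardE ltnW //; apply: max_poly_roots => //.
    by apply/allP=> x; rewrite mem_enum => /andP[_].
  exact: enum_uniq.
have d0 : 0 < d%:R :> algC by rewrite ltr0n ltnW.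
rewrite -(ler_pM2l d0) -{1}[d%:R]normr_nat -normrM mulr_sumr.
(* The deviations B - d N_z are nonnegative, so they bound the sum in absolute value by their own
   total. *)
have -> : \sum_(z : K | z ^+ d == 1) d%:R * ((Nz z)%:R * w z) =
   - \sum_(z : K | z ^+ d == 1) (B - d * Nz z)%:R * w z.
  apply/eqP; rewrite -addr_eq0 -big_split /=.
  rewrite (eq_bigr (fun z => B%:R * w z)); first by rewrite -mulr_sumr sum0 mulr0.
  by move=> z _; rewrite mulrA -natrM -mulrDl -natrD subnKC.
rewrite normrN; apply: le_trans (ler_norm_sum _ _ _) _.
apply: le_trans (_ : \sum_(z : K | z ^+ d == 1) (B - d * Nz z)%:R <= _).
  apply: ler_sum => z _; rewrite normrM normr_nat ler_piMr ?ler0n //.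
  exact: norm_fchar_le1 wP _.
rewrite -natr_sum -natrM ler_nat.
have E1 : (\sum_(z : K | (z ^+ d == 1)%R) (B - d * Nz z) + d * \sum_(z : K | (z ^+ d == 1)%R) Nz z = d * B)%N.
  rewrite big_distrr -big_split /= (eq_bigr (fun=> B)) => [|z _]; last exact: subnK.
  by rewrite sum_nat_const; congr (_ * _)%N; rewrite -[RHS]cardU.
rewrite -(leq_add2r (d * \sum_(z : K | (z ^+ d == 1)%R) Nz z)) E1 -mulnDr leq_mul2l.
apply/orP; right; rewrite /B.
have ms : (m <= s * m)%N by rewrite leq_pmull // ltnW.
rewrite mulnDr; move: sumNz ms; move: (\sum_(z : K | _) Nz z)%N (s * stepC q m)%N (s * s)%N (s * m)%N => *; lia.
Qed.
End CharSum.

(** Reciprocity of resultants: up to sign, the norm of the characteristic polynomial of x modulo f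
    is the norm of f(x) down to K. It turns lam into a character of the extension. *)
Lemma polynorm_cp (K E : finFieldType) (j : {rmorphism K -> E}) m (C : 'M[K]_m.+1) n x :
  iter n (frob j) x = x ->
  j (polynorm C (conj_poly j n x)) = (-1) ^+ (m.+1 * n) *
    (map_poly j (char_poly C)).[x] ^+ (\sum_(i < n) #|K| ^ i)%N.
Proof.
move=> xn; set g := map_poly j _.
have E1 : map_poly j (conj_poly j n x) =
    \prod_(y <- [seq iter (val i) (frob j) x | i : 'I_n]) ('X - y%:P).
  by rewrite map_cp // big_image.
rewrite (polynorm_split C E1) big_image /= big_split /= prodr_const card_ord -exprM.
congr (_ * _); rewrite expr_sum; apply: eq_bigr => i _.
rewrite -(iter_frob j); elim: (val i) => // i' IH.
by rewrite !iterS horner_frob IH.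
Qed.

Lemma mup_separable (F : fieldType) (p : {poly F}) x :
  separable_poly p -> root p x -> mup x p = 1%N.
Proof.
move=> sep px; have p0 := separable_poly_neq0 sep.
apply/eqP; rewrite eqn_leq mup_leq // mup_geq // expr1 dvdp_XsubCl px andbT.
by rewrite (separable_nosquare sep) // size_XsubC.
Qed.

Section Order.
Variables (K : finFieldType) (P1 P2 P3 : {poly K}) (a b : nat).
Notation N := (#|K|.-1).
Hypotheses (mon1 : P1 \is monic) (mon2 : P2 \is monic) (mon3 : P3 \is monic).
Hypothesis sep : separable_poly (P1 * P2 * P3).
Hypotheses (nc1 : (1 < size (P1 * P3)%R)%N) (nc2 : (1 < size (P2 * P3)%R)%N).
Hypothesis neq : (P1 != 1) || (P2 != 1).
Hypothesis nontriv : ~~ ((N %| a) && (N %| b))%N.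
Let h := (P1 * P3) ^+ a * (P2 * P3) ^+ b.

(* d is the exact order of the character attached to f^a F^b. *)
Lemma char_order : exists d, [/\ (1 < d)%N, (d %| N)%N, exists v, h ^+ d = v ^+ N &
  forall (E : finFieldType) (j : {rmorphism K -> E}),
  (forall G, G \is monic -> (size G <= size (P1 * P2 * P3)%R)%N -> G != 1 -> exists r, root (map_poly j G) r) ->
  forall i, (forall r, N %| i * mup r (map_poly j h))%N -> (d %| i)%N].
Proof.
have N0 : (0 < N)%N by rewrite -ltnS prednK ?finNzRing_gt1 // ltnW ?finNzRing_gt1.
(* A factor equal to 1 has no root from which its exponent could be read, so its exponent is set to
   0 and does not affect the gcd g. The order is d = N / g. *)
pose ex P e := if P == 1 :> {poly K} then 0%N else e : nat.
have exE (P : {poly K}) e : P ^+ e = P ^+ ex P e.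
  by rewrite /ex; case: eqP => // ->; rewrite !expr1n.
set e1 := ex P1 a; set e2 := ex P2 b; set e3 := ex P3 (a + b)%N.
have hE : h = P1 ^+ e1 * P2 ^+ e2 * P3 ^+ e3.
  by rewrite -!exE /h exprD !exprMn; ring.
pose g := gcdn N (gcdn e1 (gcdn e2 e3)).
have g0 : (0 < g)%N by rewrite gcdn_gt0 N0.
have gN : (g %| N)%N by apply: dvdn_gcdl.
have g1 : (g %| e1)%N := dvdn_trans (dvdn_gcdr N _) (dvdn_gcdl e1 _).
have g23 : (g %| gcdn e2 e3)%N := dvdn_trans (dvdn_gcdr N _) (dvdn_gcdr e1 _).
have g2 : (g %| e2)%N := dvdn_trans g23 (dvdn_gcdl e2 e3).
have g3 : (g %| e3)%N := dvdn_trans g23 (dvdn_gcdr e2 e3).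
have Nd : N = (N %/ g * g)%N by rewrite divnK.
exists (N %/ g)%N; split.
(* If d = 1, then N divides the exponent of every factor other than 1. Since P1 P3 and P2 P3 are
   nonconstant and P1, P2 are not both 1, at least two of a, b, a + b are such exponents, and any
   two give N | a and N | b. *)
- rewrite ltn_neqAle divn_gt0 // dvdn_leq // andbT eq_sym.
  apply: contra nontriv => /eqP d1; rewrite d1 mul1n in Nd; rewrite -Nd in g1 g2 g3.
  move: g1 g2 g3; rewrite /e1 /e2 /e3 /ex.
  have [p1|p1] := eqVneq P1 1; have [p3|p3] := eqVneq P3 1.
  - by move: nc1; rewrite p1 p3 mul1r size_poly1.
  - move: neq; rewrite p1 eqxx /= => /negPf -> _ Nb.
    by rewrite dvdn_addl // Nb => ->.
  - have [p2|p2] := eqVneq P2 1; first by move: nc2; rewrite p2 p3 mul1r size_poly1.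
    by move=> -> ->.
  by move=> Na _; rewrite dvdn_addr // Na.
- by rewrite {2}Nd dvdn_mulr.
- exists (P1 ^+ (e1 %/ g) * P2 ^+ (e2 %/ g) * P3 ^+ (e3 %/ g)).
  rewrite hE !exprMn -!exprM {4 5 6}Nd.
  by congr (_ ^+ _ * _ ^+ _ * _ ^+ _); rewrite mulnCA divnK // mulnC.
move=> E j hroot i Hi.
have Q0 : P1 * P2 * P3 != 0 by apply: separable_poly_neq0.
have sepE : separable_poly (map_poly j (P1 * P2 * P3)) by rewrite separable_map.
have nz p : p \is monic -> map_poly j p != 0 by move=> mp; rewrite map_poly_eq0 monic_neq0.
have mh r : mup r (map_poly j h) = (e1 * mup r (map_poly j P1) + e2 * mup r (map_poly j P2)
   + e3 * mup r (map_poly j P3))%N.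
  by rewrite hE !rmorphM !rmorphXn /= !mupM ?mulf_neq0 ?expf_neq0 ?nz // !mupX ?nz.
(* By separability a root of one factor is simple and is no root of the others, so the multiplicity
   of h there is exactly that factor's exponent. *)
have mQ r : (mup r (map_poly j P1) + mup r (map_poly j P2) + mup r (map_poly j P3) <= 1)%N.
  rewrite -!mupM ?mulf_neq0 ?nz // -!rmorphM.
  case: (boolP (root (map_poly j (P1 * P2 * P3)) r)) => [|/mupNroot -> //].
  by move/(mup_separable sepE) ->.
have mroot p r : p \is monic -> root (map_poly j p) r -> (0 < mup r (map_poly j p))%N.
  by move=> mp; rewrite -XsubC_dvd ?nz // dvdp_XsubCl.
have szle p : p %| P1 * P2 * P3 -> (size p <= size (P1 * P2 * P3)%R)%N by apply: dvdp_leq.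
have D1 : (N %| i * e1)%N.
  rewrite /e1; case: (eqVneq P1 1) => [p1|p1]; first by rewrite /ex p1 eqxx muln0 dvdn0.
  have [r rr] : exists r, root (map_poly j P1) r.
    by apply: hroot => //; rewrite szle // -mulrA dvdp_mulr.
  have := Hi r; rewrite mh; have := mQ r; have := mroot _ _ mon1 rr.
  move: (mup r (map_poly j P1)) (mup r (map_poly j P2)) (mup r (map_poly j P3)).
  move=> m1 m2 m3 lt0 le1; have [-> -> ->] : [/\ m1 = 1, m2 = 0 & m3 = 0]%N by split; move: lt0 le1; clear; lia.
  by rewrite muln1 !muln0 ?addn0 ?add0n.
have D2 : (N %| i * e2)%N.
  rewrite /e2; case: (eqVneq P2 1) => [p1|p1]; first by rewrite /ex p1 eqxx muln0 dvdn0.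
  have [r rr] : exists r, root (map_poly j P2) r.
    by apply: hroot => //; rewrite szle // mulrAC dvdp_mull.
  have := Hi r; rewrite mh; have := mQ r; have := mroot _ _ mon2 rr.
  move: (mup r (map_poly j P1)) (mup r (map_poly j P2)) (mup r (map_poly j P3)).
  move=> m1 m2 m3 lt0 le1; have [-> -> ->] : [/\ m1 = 0, m2 = 1 & m3 = 0]%N by split; move: lt0 le1; clear; lia.
  by rewrite muln1 !muln0 ?addn0 ?add0n.
have D3 : (N %| i * e3)%N.
  rewrite /e3; case: (eqVneq P3 1) => [p1|p1]; first by rewrite /ex p1 eqxx muln0 dvdn0.
  have [r rr] : exists r, root (map_poly j P3) r.
    by apply: hroot => //; rewrite szle // dvdp_mull.
  have := Hi r; rewrite mh; have := mQ r; have := mroot _ _ mon3 rr.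
  move: (mup r (map_poly j P1)) (mup r (map_poly j P2)) (mup r (map_poly j P3)).
  move=> m1 m2 m3 lt0 le1; have [-> -> ->] : [/\ m1 = 0, m2 = 0 & m3 = 1]%N by split; move: lt0 le1; clear; lia.
  by rewrite muln1 !muln0 ?addn0 ?add0n.
rewrite -(dvdn_pmul2r g0) -Nd /g !muln_gcdr !dvdn_gcd D1 D2 D3 dvdn_mull //.
Qed.
End Order.

(** * The Weil bound *)

Section Weil.
Variables (K : finFieldType) (w : K -> algC) (P1 P2 P3 : {poly K}) (a b : nat).
Hypothesis wP : faithful_char w.
Notation q := #|K|.
Notation N := (#|K|.-1).
Hypotheses (mon1 : P1 \is monic) (mon2 : P2 \is monic) (mon3 : P3 \is monic).
Hypothesis sep : separable_poly (P1 * P2 * P3).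
Hypotheses (nc1 : (1 < size (P1 * P3)%R)%N) (nc2 : (1 < size (P2 * P3)%R)%N).
Hypothesis neq : (P1 != 1) || (P2 != 1).
Hypothesis nontriv : ~~ ((N %| a) && (N %| b))%N.
Hypotheses (a0 : (0 < a)%N) (b0 : (0 < b)%N).
Let f := P1 * P3.
Let F := P2 * P3.
Let M := P1 * P2 * P3.
Let h := f ^+ a * F ^+ b.
Let q1 : (1 < q)%N := finNzRing_gt1 K.

Variables (n1 n2 : nat) (C1 : 'M[K]_n1.+1) (C2 : 'M[K]_n2.+1).
Hypotheses (CP1 : char_poly C1 = f) (CP2 : char_poly C2 = F).

Let lam (G : {poly K}) := w (polynorm C1 G ^+ a * polynorm C2 G ^+ b).

Let lamM G H : lam (G * H) = lam G * lam H.
Proof. by rewrite /lam !polynormM !exprMn mulrACA fcharM. Qed.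

Let lam1 : lam 1 = 1.
Proof. by rewrite /lam !polynorm1 !expr1n mulr1 fchar1. Qed.

Let lam_mod G H : M %| G - H -> lam G = lam H.
Proof.
move=> dv; rewrite /lam (@polynorm_mod _ _ C1 G H) 1?(@polynorm_mod _ _ C2 G H) //.
  by rewrite CP2; apply: dvdp_trans dv; rewrite /M /F -mulrA dvdp_mull.
by rewrite CP1; apply: dvdp_trans dv; rewrite /M /f mulrAC dvdp_mulr.
Qed.

Let h0 : h != 0.
Proof. by rewrite mulf_neq0 ?expf_neq0 // /f /F monic_neq0 ?monicMl. Qed.

Let Cst := (stepC q (size h) + size h)%N.

(* The field in which the recursion and Stepanov's bound take place at level n. *)
Let ext n : exists (E : finFieldType) (j : {rmorphism K -> E}),
  (forall G : {poly K}, G \is monic -> (size G <= maxn (q ^ n).+1 (maxn n.+1 (size M)))%N ->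
    exists rs, map_poly j G %= \prod_(x <- rs) ('X - x%:P)) /\
  ((0 < n)%N -> #|[set x : E | x ^+ (q ^ n)%N == x]| = (q ^ n)%N).
Proof.
have [E [j spl]] := finField_splitting_ext K (maxn (q ^ n).+1 (maxn n.+1 (size M))).
exists E, j; split=> [G monG szG|n0]; first by apply: spl; rewrite ?monic_neq0.
have qn1 : (1 < q ^ n)%N by rewrite -(exp1n n) ltn_exp2r.
have szX : size ('X^(q ^ n) - 'X : {poly K}) = (q ^ n).+1.
  by rewrite size_polyDl ?size_polyXn // size_polyN size_polyX.
have [||rs eq_rs] := spl ('X^(q ^ n) - 'X).
- by rewrite -size_poly_gt0 szX.
- by rewrite szX leq_maxl.
exact: card_fixed n0 eq_rs.
Qed.

(** At the even level t + t the signs from [polynorm_cp] are trivial, and 1 + q + ... + q^(2t-1) = k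
    (s + 1) is the exponent of Stepanov's fibres. *)
Let lam_cp (E : finFieldType) (j : {rmorphism K -> E}) t k x y :
  (q ^ t = (N * k).+1)%N -> x ^+ (q ^ t * q ^ t)%N = x ->
  j y = (map_poly j h).[x] ^+ (k * (q ^ t).+1) -> lam (conj_poly j (t + t) x) = w y.
Proof.
move=> def_s; rewrite -expnD -(iter_frob j) => xfix jy.
congr (w _); apply: (fmorph_inj j); rewrite jy rmorphM !rmorphXn /= !polynorm_cp //.
have even m : (-1) ^+ (m * (t + t)) = 1 :> E by rewrite mulnDr exprD -expr2 sqrr_sign.
have -> : (\sum_(i < t + t) q ^ i = k * (q ^ t).+1)%N.
  have N0 : (0 < N)%N by rewrite -ltnS prednK // ltnW.
  apply/eqP; rewrite -(eqn_pmul2l N0) -predn_exp expnD mulnA.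
  by rewrite {1 2}def_s; apply/eqP; lia.
have -> : map_poly j h = map_poly j f ^+ a * map_poly j F ^+ b.
  by rewrite /h rmorphM !rmorphXn.
rewrite !even !mul1r CP1 CP2 hornerM !horner_exp exprMn.
by rewrite -!exprM ![(_ * (k * _))%N]mulnC.
Qed.

Let big t := (1 < t)%N && ((q ^ 2 * (size h).+1).+1 < q ^ (t - 2))%N.

Let psum_bound t (E : finFieldType) (j : {rmorphism K -> E}) : big t ->
  #|[set x : E | x ^+ (q ^ (t + t))%N == x]| = (q ^ (t + t))%N ->
  (forall G : {poly K}, G \is monic -> (size G <= size M)%N ->
    exists rs, map_poly j G %= \prod_(x <- rs) ('X - x%:P)) ->
  `|power_sum j lam (t + t)| <= (q ^ t * Cst)%:R.
Proof.
case/andP=> t1 t_big fixE spl.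
have [d [d1 dN hd Hd]] := char_order mon1 mon2 mon3 sep nc1 nc2 neq nontriv.
have [k def_s] : exists k, (q ^ t = (N * k).+1)%N.
  exists (\sum_(i < t) q ^ i)%N; rewrite -predn_exp prednK // expn_gt0 ltnW //.
rewrite /power_sum (eq_bigl (fun x : E => x ^+ (q ^ t * q ^ t)%N == x)); last first.
  by move=> x; rewrite iter_frob expnD.
rewrite /Cst -(size_map_poly j).
apply: (char_sum_bound wP h0 def_s t1 _ hd _ d1 dN).
- by rewrite size_map_poly.
- apply: Hd => G monG szG G1; have [rs eq_rs] := spl G monG szG.
  case: rs eq_rs => [|r rs] eq_rs; last first.
    by exists r; rewrite (eqp_root eq_rs) root_prod_XsubC mem_head.
  case/eqP: G1; apply/eqP; rewrite -eqp_monic ?monic1 // -(eqp_map j).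
  by rewrite rmorph1; rewrite big_nil in eq_rs.
- by rewrite -expnD.
by move=> x y; apply: lam_cp.
Qed.

Let big_exists (X : nat) : exists t0, forall t, (t0 <= t)%N -> big t /\ (X < q ^ t)%N.
Proof.
exists (X + (q ^ 2 * (size h).+1).+1 + 3)%N => t le_t; split.
  apply/andP; split; first by rewrite (leq_trans _ le_t) // addn3.
  by apply: leq_trans (ltn_expl _ q1); rewrite ltnS; move: le_t; set Y := (_.+1)%N; clear; lia.
by apply: leq_trans (ltn_expl _ q1); move: le_t; set Y := (_.+1)%N; clear; lia.
Qed.

Let root_h (E : finFieldType) (j : {rmorphism K -> E}) y :
  root (map_poly j M) y -> root (map_poly j h) y.
Proof.
rewrite /M /h /f /F !rmorphM !rmorphXn /= !rootM.
rewrite (root_exp (mulrC _ _) a0) (root_exp (mulrC _ _) b0) !rmorphM /= !rootM.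
by case: (root _ y); case: (root _ y); case: (root _ y).
Qed.

(* If lam took only the values 0 and 1, the sum S_(2t) would be about q^(2t),
   against Stepanov's bound. *)
Let lam_nontriv : exists U : {poly K}, coprimep U M /\ lam U != 1.
Proof.
(* Once q^t0 exceeds Cst + size h, the value q^(2 t0) - size h exceeds the bound q^t0 Cst. *)
have [t0 /(_ t0 (leqnn _))[bt ltX]] := big_exists (Cst + size h)%N.
have [t1 _] := andP bt.
have [E [j [spl fixE]]] := ext (t0 + t0).
have {}fixE : #|[set x : E | x ^+ (q ^ (t0 + t0))%N == x]| = (q ^ (t0 + t0))%N.
  by apply: fixE; rewrite addn_gt0 ltnW.
have [k def_s] : exists k, (q ^ t0 = (N * k).+1)%N.
  exists (\sum_(i < t0) q ^ i)%N; rewrite -predn_exp prednK // expn_gt0 ltnW //.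
have bound : `|power_sum j lam (t0 + t0)| <= (q ^ t0 * Cst)%:R.
  apply: psum_bound => // G monG szG; apply: spl => //.
  by rewrite !leq_max szG !orbT.
pose P (x : E) := x ^+ (q ^ (t0 + t0))%N == x.
have lam0 x : P x -> (map_poly j h).[x] = 0 -> lam (conj_poly j (t0 + t0) x) = 0.
  rewrite /P expnD => /eqP fx hx; rewrite (lam_cp (y := 0) def_s fx) ?fchar0 //.
  rewrite hx rmorph0 expr0n gtn_eqF // muln_gt0 andbT lt0n.
  apply: contraTneq ltX => k0; rewrite def_s k0 muln0 -leqNgt.
  by rewrite addn_gt0 [X in _ || X]size_poly_gt0 h0 orbT.
case: (pickP [pred x | [&& P x, (map_poly j h).[x] != 0 & lam (conj_poly j (t0 + t0) x) != 1]]).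
  move=> x /and3P[/eqP fx hx lx]; exists (conj_poly j (t0 + t0) x); split=> //.
  rewrite -(coprimep_map j) map_cp ?iter_frob // /conj_polyE.
  apply: (big_ind (fun p => coprimep p (map_poly j M))); first exact: coprime1p.
    by move=> u v cu cv; rewrite coprimepMl cu cv.
  move=> i _; rewrite coprimep_sym coprimep_XsubC; apply: contra hx => /root_h.
  rewrite rootE; elim: (val i) => //= i' IH.
  by rewrite horner_frob fmorph_eq0.
move=> none; move: bound; rewrite /power_sum.
rewrite (eq_bigl P) => [|x]; last by rewrite /P iter_frob.
rewrite (eq_bigr (fun x => ((map_poly j h).[x] != 0)%:R)) => [|x Px]; last first.
  have [hx|hx] := eqVneq (map_poly j h).[x] 0; first by rewrite lam0.
  by move: (none x); rewrite /= Px hx => /negbT /negPn /eqP.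
rewrite -natr_sum normr_nat ler_nat leqNgt => /negP[].
have : (q ^ t0 * q ^ t0 <= \sum_(x | P x) ((map_poly j h).[x] != 0)%R + size h)%N.
  rewrite -expnD -fixE -sum1dep_card (bigID (fun x => (map_poly j h).[x] == 0)) /= addnC.
  apply: leq_add.
    rewrite [X in (_ <= X)%N]big_mkcond [X in (X <= _)%N]big_mkcond; apply: leq_sum => x _.
    by rewrite /P; case: (_ == x) => //=; case: (_ == 0).
  rewrite sum1dep_card cardE ltnW // -(size_map_poly j); apply: max_poly_roots.
  - by rewrite map_poly_eq0.
  - by apply/allP=> x; rewrite mem_enum inE => /andP[].
  exact: enum_uniq.
have := leq_mul (leqnn (q ^ t0)) ltX.
rewrite mulnS mulnDr; have : (0 < q ^ t0)%N by rewrite expn_gt0 ltnW.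
have : (size h <= q ^ t0 * size h)%N by rewrite leq_pmull // expn_gt0 ltnW.
move: (q ^ t0 * Cst)%N (q ^ t0 * size h)%N (size h) (q ^ t0 * q ^ t0)%N (q ^ t0)%N.
move: (\sum_(_ | _) _)%N; clear; lia.
Qed.

(* Multiplication by U permutes the residues modulo M, hence the monic
   polynomials of degree n with a given quotient by M. *)
Let csum_vanish n : ((size M).-1 <= n)%N -> monic_sum lam n = 0.
Proof.
have [U [cop lamU]] := lam_nontriv.
have M0 : M != 0 by rewrite separable_poly_neq0.
move=> le_n; pose G (v : 'rV[K]_n) := mon v - mon v %% M + (U * mon v) %% M.
have szr (p : {poly K}) : (size (p %% M)%R <= n)%N.
  by rewrite (leq_trans _ le_n) // -ltnS prednK ?ltn_modp ?size_poly_gt0.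
have szG (v : 'rV[K]_n) : (size (- (mon v %% M) + (U * mon v) %% M)%R < size (mon v))%N.
  rewrite size_mon ltnS (leq_trans (size_polyD _ _)) // geq_max size_polyN.
  by rewrite !szr.
have monG v : G v \is monic.
  by rewrite /G -addrA monicE lead_coefDl // (monicP (monic_mon v)).
have sG v : size (G v) = n.+1 by rewrite /G -addrA size_polyDl // size_mon.
have Ginj : injective (fun v => unmon n (G v)).
  move=> v v' /(congr1 (@mon _ _)); rewrite !unmonK // => eqG.
  apply: (can_inj (@monK _ _)).
  have modG u : G u %% M = (U * mon u) %% M.
    rewrite /G {1}(divp_eq (mon u) M) addrK modpD modp_mull add0r modp_id //.
  have eqr : (U * mon v) %% M = (U * mon v') %% M by rewrite -!modG eqG.
  have eqm : mon v %% M = mon v' %% M.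
    apply/eqP; rewrite -subr_eq0 -modpN -modpD -/(M %| _).
    rewrite -(Gauss_dvdpr _ (_ : coprimep M U)) 1?coprimep_sym //.
    by rewrite /dvdp mulrBr modpD modpN eqr subrr.
  by move: eqG; rewrite /G eqr eqm => /addIr /addIr.
have : monic_sum lam n = lam U * monic_sum lam n.
  rewrite {1}/monic_sum (reindex_inj Ginj) /= /monic_sum mulr_sumr; apply: eq_bigr => v _.
  rewrite unmonK // -lamM; apply: lam_mod.
  have -> : G v - U * mon v = (mon v - mon v %% M) - (U * mon v - (U * mon v) %% M).
    by rewrite /G; ring.
  by rewrite dvdp_sub // /dvdp modpD modpN modp_id subrr.
move/eqP; rewrite -subr_eq0 -{1}[monic_sum _ _]mul1r -mulrBl mulf_eq0 subr_eq0 eq_sym.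
by rewrite (negPf lamU) => /eqP.
Qed.

Let csum_bound : `|monic_sum lam 1| <= (size M).-2%:R * sqrtC q%:R.
Proof.
have q0 : 0 < q%:R :> algC by rewrite ltr0n ltnW.
have c0 : monic_sum lam 0 = 1.
  rewrite /monic_sum (big_pred1 0) => [|v]; last by rewrite /= (thinmx0 v) eqxx.
  by rewrite /mon linear0 addr0 lam1.
have cD n : ((size M).-2 < n)%N -> monic_sum lam n = 0.
  by move=> lt; apply: csum_vanish; rewrite (leq_trans (leqSpred _)).
have [ws szws wsP] := newton_roots c0 cD.
have psumE t (E : finFieldType) (j : {rmorphism K -> E}) : (0 < t)%N ->
    (forall G : {poly K}, G \is monic -> (size G <= t.+1)%N ->
      exists rs, map_poly j G %= \prod_(x <- rs) ('X - x%:P)) ->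
    power_sum j lam t = - \sum_(z <- ws) z ^+ t.
  move=> t0 spl; apply: wsP => // m le_m; apply: (@csum_rec K E j lam lamM m) => G monG szG.
  by apply: spl; rewrite ?szG.
have [t0 big_t0] := big_exists 0.
(* Bounds are available at even levels only, so they are read as bounds on the t-th power sums of
   the numbers z^2 / q. *)
have bd : {in [seq z ^+ 2 / q%:R | z <- ws], forall z, `|z| <= 1}.
  apply: (@bounded_power_sums _ Cst%:R t0) => t /big_t0 [bt _].
  have [t1 _] := andP bt.
  have [E [j [spl fixE]]] := ext (t + t).
  have tt0 : (0 < t + t)%N by rewrite addn_gt0 ltnW.
  have := @psum_bound t E j bt (fixE tt0); rewrite (psumE _ _ _ tt0); last first.
    by move=> G monG szG; apply: spl => //; rewrite !leq_max szG !orbT.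
  move=> bd; rewrite big_map.
  have -> : \sum_(z <- ws) (z ^+ 2 / q%:R) ^+ t = (\sum_(z <- ws) z ^+ (t + t)) / q%:R ^+ t.
    rewrite mulr_suml; apply: eq_bigr => z _.
    by rewrite expr_div_n -exprM mul2n addnn.
  rewrite normrM normfV normrX normr_nat ler_pdivrMr ?exprn_gt0 //.
  rewrite -natrX -natrM mulnC -normrN; apply: bd => G monG szG.
  by apply: spl => //; rewrite !leq_max szG !orbT.
have bd' z : z \in ws -> `|z| <= sqrtC q%:R.
  move=> zz; have /(map_f (fun z => z ^+ 2 / q%:R)) /bd := zz.
  rewrite normrM normfV normrX normr_nat ler_pdivrMr // mul1r => le2.
  by rewrite -(ler_pXn2r (_ : 0 < 2)%N) ?nnegrE ?sqrtC_ge0 ?ler0n // sqrtCK.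
(* At level 1 the recursion is just c_1 = S_1 c_0 with c_0 = 1, so the constant sequence c_1
   satisfies it. *)
rewrite (wsP (fun=> monic_sum lam 1) 1%N) //; last first.
  case=> [|[|m]] // _; first by rewrite big_ord0 mul0r.
  by rewrite big_ord1 subnn c0 mulr1 mul1r.
rewrite normrN; apply: le_trans (ler_norm_sum _ _ _) _.
apply: le_trans (_ : (size ws)%:R * sqrtC q%:R <= _); last first.
  by rewrite ler_wpM2r ?sqrtC_ge0 ?ler0n // ler_nat.
rewrite -sum1_size natr_sum mulr_suml big_seq [X in _ <= X]big_seq.
by apply: ler_sum => z zz; rewrite expr1 mul1r bd'.
Qed.

Lemma weil_companion :
  `|\sum_(x : K) w ((P1 * P3).[x] ^+ a * (P2 * P3).[x] ^+ b)|
    <= (size (P1 * P2 * P3)%R).-2%:R * sqrtC q%:R.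
Proof.
apply: le_trans csum_bound; rewrite -/f -/F le_eqVlt; apply/orP; left; apply/eqP.
(* The norm of X - x modulo f is f(x) up to the sign (-1)^(deg f), likewise for F; sg collects both
   signs and w(sg) has modulus 1. *)
pose sg : K := ((-1) ^+ n1.+1) ^+ a * ((-1) ^+ n2.+1) ^+ b.
have sg0 : sg != 0 by rewrite mulf_neq0 // !expf_neq0 // oppr_eq0 oner_eq0.
have vinj : injective (fun x : K => - (const_mx x : 'rV[K]_1)).
  by move=> x y /oppr_inj /matrixP /(_ 0 0); rewrite !mxE.
have vK : cancel (fun v : 'rV[K]_1 => - v 0 0) (fun x : K => - (const_mx x : 'rV[K]_1)).
  by move=> v; apply/rowP=> i; rewrite !mxE opprK ord1.
have -> : monic_sum lam 1 = w sg * \sum_(x : K) w (f.[x] ^+ a * F.[x] ^+ b).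
  rewrite /monic_sum (reindex (fun x : K => - (const_mx x : 'rV[K]_1))) /=; last first.
    by exists (fun v : 'rV[K]_1 => - v 0 0) => v _; [apply: vinj; rewrite vK | rewrite vK].
  rewrite mulr_sumr; apply: eq_bigr => x _; rewrite -fcharM //; congr (w _).
  have E1 : map_poly idfun (mon (- (const_mx x : 'rV[K]_1))) =
      \prod_(y <- [:: x]) ('X - y%:P).
    rewrite big_seq1 map_poly_id // /mon expr1 linearN /=; congr (_ - _).
    apply/polyP=> i; rewrite coef_rVpoly coefC; case: insubP => [u|].
      by rewrite ltnS leqn0 mxE => _ /= <-; rewrite ord1.
    by case: i.
  have nE m (C : 'M[K]_m.+1) : polynorm C (mon (- (const_mx x : 'rV[K]_1))) =
      (-1) ^+ m.+1 * (char_poly C).[x].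
    by rewrite -[LHS]/(idfun _) (polynorm_split C E1) big_seq1 map_poly_id.
  by rewrite !nE CP1 CP2 !exprMn /sg; ring.
by rewrite normrM norm_fchar // mul1r.
Qed.
End Weil.

Theorem weil_bound (K : finFieldType) (w : K -> algC) (P1 P2 P3 : {poly K}) (a b : nat) :
  faithful_char w -> P1 \is monic -> P2 \is monic -> P3 \is monic ->
  separable_poly (P1 * P2 * P3) ->
  (1 < size (P1 * P3)%R)%N -> (1 < size (P2 * P3)%R)%N ->
  (P1 != 1) || (P2 != 1) -> ~~ ((#|K|.-1 %| a) && (#|K|.-1 %| b))%N ->
  (0 < a)%N -> (0 < b)%N ->
  `|\sum_(x : K) w ((P1 * P3).[x] ^+ a * (P2 * P3).[x] ^+ b)|
    <= (size (P1 * P2 * P3)%R).-2%:R * sqrtC #|K|%:R.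
Proof.
move=> wP m1 m2 m3 sep nc1 nc2 neq nontriv a0 b0.
have [n1 [C1 CP1]] := char_poly_surj (rpredM m1 m3) nc1.
have [n2 [C2 CP2]] := char_poly_surj (rpredM m2 m3) nc2.
exact: weil_companion CP1 CP2.
Qed.

(** * Free elements *)

(** The products over subsets of [primes r], listed by L, are pairwise distinct squarefree divisors
    of r. *)
Lemma exp2_primes_le_W r : (0 < r)%N -> (2 ^ size (primes r) <= W r)%N.
Proof.
move=> r0; pose L := foldr (fun p l => l ++ [seq p * d | d <- l])%N [:: 1%N].
have key ps : uniq ps -> {subset ps <= primes r} ->
  [/\ size (L ps) = (2 ^ size ps)%N, uniq (L ps) &
      forall d, d \in L ps -> [/\ (d %| r)%N, sqfree_nat d & {subset primes d <= ps}]].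
  elim: ps => [|p ps IH] /=.
    by move=> _ _; split=> // d; rewrite inE => /eqP ->; split; rewrite ?dvd1n.
  case/andP=> p_ps ups sub.
  have [|sz uL LP] := IH ups; first by move=> x xs; apply: sub; rewrite inE xs orbT.
  have : p \in primes r by apply: sub; rewrite mem_head.
  rewrite mem_primes => /and3P[pr_p _ p_r].
  have p_d d : d \in L ps -> ~~ (p %| d)%N.
    move=> /LP[d_r _ sub_d]; apply: contra p_ps => pd; apply: sub_d.
    by rewrite mem_primes pr_p pd (dvdn_gt0 r0 d_r).
  split.
  - by rewrite size_cat size_map sz expnS mul2n addnn.
  - rewrite cat_uniq uL map_inj_uniq ?uL ?andbT //=; last first.
      by move=> x y /eqP; rewrite eqn_pmul2l ?prime_gt0 // => /eqP.
    by apply/hasPn=> _ /mapP[d _ ->]; apply/negP=> /p_d; rewrite dvdn_mulr.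
  move=> d; rewrite mem_cat => /orP[/LP[d_r sq sub_d]|/mapP[e eL ->]].
    by split=> // x /sub_d xs; rewrite inE xs orbT.
  have [e_r sq sub_e] := LP _ eL; have e0 := dvdn_gt0 r0 e_r.
  have cpe : coprime p e by rewrite prime_coprime // p_d.
  have pr_pe x : x \in primes (p * e) = (x == p) || (x \in primes e).
    by rewrite primesM ?(prime_gt0 pr_p) // primes_prime // inE.
  split.
  - by rewrite Gauss_dvd // p_r.
  - apply/allP=> l; rewrite pr_pe => /orP[/eqP ->|le].
      by rewrite dvdn_pmul2l ?prime_gt0 // p_d.
    have lp : l != p.
      by apply: contraTneq le => ->; rewrite mem_primes (negPf (p_d _ eL)) !andbF.
    have pr_l : prime l by move: le; rewrite mem_primes => /and3P[].
    rewrite Gauss_dvdr; first exact: (allP sq).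
    by rewrite coprimeMl andbb prime_coprime // dvdn_prime2.
  by move=> x; rewrite pr_pe inE => /orP[->//|/sub_e ->]; rewrite orbT.
have [sz uL LP] := key _ (primes_uniq r) (fun x => id).
rewrite -sz /W -size_filter; apply: uniq_leq_size => // d /LP[d_r sq _].
by rewrite mem_filter sq -dvdn_divisors.
Qed.

Lemma totient_prod r : (0 < r)%N ->
  \prod_(p <- primes r) (1 - p%:R^-1) = (totient r)%:R / r%:R :> algC.
Proof.
move=> r0; rewrite totientE // natr_prod.
have -> : r%:R = \prod_(p <- primes r) (p ^ logn p r)%:R :> algC.
  rewrite {1}[r]prod_prime_decomp // prime_decompE big_map natr_prod.
  by apply: eq_bigr.
rewrite -prodf_div; apply: eq_big_seq => p; rewrite mem_primes => /and3P[pr_p _ p_r].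
have p0 : p%:R != 0 :> algC by rewrite pnatr_eq0 -lt0n prime_gt0.
have l0 : (0 < logn p r)%N by rewrite logn_gt0 mem_primes pr_p r0.
rewrite -{2}(prednK l0) expnS !natrM -mulf_div divff ?mulr1; last first.
  by rewrite natrX expf_neq0.
by rewrite -subn1 natrB ?prime_gt0 // mulrBl divff // mul1r.
Qed.

Lemma count_coprime r k : (0 < r)%N ->
  (\sum_(0 <= i < k * r) coprime r i = k * totient r)%N.
Proof.
move=> r0; elim: k => [|k IH]; first by rewrite big_geq.
rewrite mulSnr (big_cat_nat (n := k * r)) ?leq_addr //= IH mulSnr; congr (_ + _)%N.
rewrite totient_count_coprime -{1}[(k * r)%N]add0n [(k * r + r)%N]addnC big_addn addnK.
by apply: eq_bigr => i _; rewrite -coprime_modr addnC modnMDl coprime_modr.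
Qed.

Section Free.
Variables (K : finFieldType) (n r : nat).
Notation N := (#|K|.-1).
Hypotheses (nN : (n %| N)%N) (rm : (r %| N %/ n)%N).
Let m := (N %/ n)%N.
Let N0 : (0 < N)%N.
Proof. by rewrite -ltnS prednK ?finNzRing_gt1 // ltnW ?finNzRing_gt1. Qed.
Let Nnm : N = (n * m)%N. Proof. by rewrite mulnC divnK. Qed.
Let n0 : (0 < n)%N. Proof. exact: dvdn_gt0 N0 nN. Qed.
Let m0 : (0 < m)%N. Proof. by rewrite divn_gt0 // dvdn_leq. Qed.
Let r0 : (0 < r)%N. Proof. exact: dvdn_gt0 m0 rm. Qed.

Let prim_neq0 (g : K) : N.-primitive_root g -> g != 0.
Proof.
move=> prim_g; apply/eqP=> g0; have/eqP := prim_expr_order prim_g.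
by rewrite g0 expr0n gtn_eqF // eq_sym oner_eq0.
Qed.

(** In the cyclic group of order m, for a prime p dividing m, the p-th powers are the x with x^(m/p)
    = 1; an s-th power with s > 1 is a p-th power for any prime p dividing s. *)
Definition freeb (x : K) :=
  [&& x != 0, x ^+ m == 1 & all (fun p => x ^+ (m %/ p) != 1) (primes r)].

Lemma prime_dvd_m p : p \in primes r -> (p %| m)%N.
Proof. by rewrite mem_primes => /and3P[_ _ pr]; apply: dvdn_trans pr rm. Qed.

Lemma rn_freeP x : rn_free r n x <-> freeb x.
Proof.
have [g prim_g] := finField_prim_root K.
rewrite /freeb /rn_free /inCsub /Qord -/m; split.
  case=> -[x0 xm] free; rewrite x0 xm eqxx /=; apply/allP=> p pr.
  have pr_p : prime p by move: pr; rewrite mem_primes => /and3P[].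
  apply/eqP=> xp; have [i xi] := prim_rootP prim_g (expf_card1 x0).
  have dv : (n * p %| i)%N.
    move/eqP: xp; rewrite xi -exprM -(prim_order_dvd prim_g) {1}Nnm.
    have mp := prime_dvd_m pr.
    rewrite -{1}(divnK mp) mulnA [(n * _ * _)%N]mulnAC dvdn_pmul2r //.
    by rewrite divn_gt0 ?prime_gt0 // dvdn_leq.
  have p1 : p = 1%N.
    apply: (free (g ^+ (n * (i %/ (n * p)))%N)); last 2 first.
    - by move: pr; rewrite mem_primes => /and3P[].
    - rewrite -exprM xi; congr (_ ^+ _).
      by rewrite -{1}(divnK dv) mulnAC [RHS]mulnC mulnA.
    split; first by rewrite expf_neq0 // (prim_neq0 prim_g).
    by rewrite -exprM mulnAC -Nnm exprM (prim_expr_order prim_g) expr1n.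
  by rewrite p1 in pr_p.
case/and3P=> x0 /eqP xm /allP free; split=> // y s [y0 ym] sr xy.
apply/eqP/negPn/negP=> s1.
have s0 : (0 < s)%N := dvdn_gt0 r0 sr.
have s2 : (1 < s)%N by rewrite ltn_neqAle eq_sym s1.
have ps := pdiv_dvd s; have pr : pdiv s \in primes r.
  by rewrite mem_primes pdiv_prime // r0 (dvdn_trans ps).
case/eqP: (free _ pr); rewrite xy -exprM.
have mp := prime_dvd_m pr.
by rewrite -{1}(divnK ps) -mulnA [(pdiv s * _)%N]mulnC divnK // mulnC exprM ym expr1n.
Qed.

(** The free elements are the g^(n i) with i < m coprime to r, and [0, m) consists of m / r full
    periods modulo r. *)
Lemma card_freeb : (#|[set x | freeb x]| * r = totient r * m)%N.
Proof.
have [g prim_g] := finField_prim_root K.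
have g0 := prim_neq0 prim_g.
have inj : injective (fun i : 'I_m => g ^+ (n * i)).
  move=> i i' /eqP; rewrite (eq_prim_root_expr prim_g) !modn_small; last 2 first.
  - by rewrite Nnm ltn_pmul2l.
  - by rewrite Nnm ltn_pmul2l.
  by rewrite eqn_pmul2l // => /eqP /val_inj.
have free_i (i : 'I_m) : freeb (g ^+ (n * i)) = coprime r i.
  rewrite /freeb expf_neq0 //= -exprM mulnAC -Nnm exprM (prim_expr_order prim_g).
  rewrite expr1n eqxx /=.
  have E p : p \in primes r -> (g ^+ (n * i) ^+ (m %/ p) != 1) = ~~ (p %| i)%N.
    move=> pr; have mp := prime_dvd_m pr.
    have pr_p : prime p by move: pr; rewrite mem_primes => /and3P[].
    rewrite -exprM -(prim_order_dvd prim_g) {1}Nnm -{1}(divnK mp) -mulnA.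
    by rewrite dvdn_pmul2l // mulnC dvdn_pmul2r // divn_gt0 ?prime_gt0 // dvdn_leq.
  rewrite (eq_in_all E); apply/allP/idP => [all_p|cop p].
    apply/negPn/negP=> ncop; have g1 : (1 < gcdn r i)%N.
      by rewrite ltn_neqAle eq_sym gcdn_gt0 r0 andbT.
    have := all_p (pdiv (gcdn r i)); rewrite mem_primes pdiv_prime // r0.
    rewrite (dvdn_trans (pdiv_dvd _) (dvdn_gcdl _ _)) => /(_ isT) /negP[].
    exact: dvdn_trans (pdiv_dvd _) (dvdn_gcdr _ _).
  rewrite mem_primes => /and3P[pr_p _ pr]; apply/negP=> pi.
  have : (p %| gcdn r i)%N by rewrite dvdn_gcd pr.
  by rewrite (eqP cop) dvdn1 => /eqP p1; rewrite p1 in pr_p.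
have -> : [set x | freeb x] = [set g ^+ (n * val i) | i in [set i : 'I_m | coprime r i]].
  apply/setP=> x; rewrite inE; apply/idP/imsetP => [fx|[i]]; last first.
    by rewrite inE -free_i => fi ->.
  have /and3P[x0 /eqP xm _] := fx.
  have [k xk] := prim_rootP prim_g (expf_card1 x0).
  have nk : (n %| k)%N.
    by move/eqP: xm; rewrite xk -exprM -(prim_order_dvd prim_g) {1}Nnm dvdn_pmul2r.
  have lt_k : (k %/ n < m)%N by rewrite ltn_divLR // mulnC -Nnm.
  have xE : x = g ^+ (n * (Ordinal lt_k)) by rewrite xk mulnC divnK.
  by exists (Ordinal lt_k); rewrite // inE -free_i -xE.
rewrite card_imset // -sum1dep_card big_mkcond /=.
rewrite -(big_mkord xpredT (fun i => if coprime r i then 1 else 0)%N).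
rewrite (eq_bigr (fun i => nat_of_bool (coprime r i))) => [|i _]; last by case: coprime.
have mr : m = (m %/ r * r)%N by rewrite divnK.
by rewrite {1}mr count_coprime // mulnAC -mr mulnC.
Qed.
End Free.

(* A list of pairs (c, t) stands for the combination sum c chi^t of the powers
   of a fixed character chi. *)
Definition char_eval (s : seq (algC * nat)) (y : algC) := \sum_(c <- s) c.1 * y ^+ c.2.
Definition char_l1 (s : seq (algC * nat)) := \sum_(c <- s) `|c.1|.
Definition char_mul (s s' : seq (algC * nat)) :=
  [seq (c.1 * d.1, (c.2 + d.2)%N) | c <- s, d <- s'].

Lemma evcM s s' y : char_eval (char_mul s s') y = char_eval s y * char_eval s' y.
Proof.
rewrite /char_eval /char_mul big_allpairs_dep mulr_suml; apply: eq_bigr => c _.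
by rewrite mulr_sumr; apply: eq_bigr => d _; rewrite /= exprD mulrACA.
Qed.

Lemma l1cM s s' : char_l1 (char_mul s s') = char_l1 s * char_l1 s'.
Proof.
rewrite /char_l1 /char_mul big_allpairs_dep mulr_suml; apply: eq_bigr => c _.
by rewrite mulr_sumr; apply: eq_bigr => d _; rewrite /= normrM.
Qed.

Lemma sum_geom_unity (u : algC) p : u ^+ p = 1 ->
  \sum_(k < p) u ^+ k = if u == 1 then p%:R else 0.
Proof.
case: eqP => [-> _|/eqP u1 up].
  by rewrite (eq_bigr (fun=> 1)) ?sumr_const ?card_ord // => k _; rewrite expr1n.
apply: (mulfI (_ : u - 1 != 0)); first by rewrite subr_eq0.
by rewrite mulr0 -subrX1 up subrr.
Qed.

Section Indicator.
Variables (K : finFieldType) (w : K -> algC) (n r : nat).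
Hypothesis wP : faithful_char w.
Notation N := (#|K|.-1).
Hypotheses (nN : (n %| N)%N) (rm : (r %| N %/ n)%N).
Let m := (N %/ n)%N.
Let N0 : (0 < N)%N.
Proof. by rewrite -ltnS prednK ?finNzRing_gt1 // ltnW ?finNzRing_gt1. Qed.
Let Nnm : N = (n * m)%N. Proof. by rewrite mulnC divnK. Qed.
Let n0 : (0 < n)%N. Proof. exact: dvdn_gt0 N0 nN. Qed.
Let m0 : (0 < m)%N. Proof. by rewrite divn_gt0 // dvdn_leq. Qed.
Let r0 : (0 < r)%N. Proof. exact: dvdn_gt0 m0 rm. Qed.

Lemma fchar_eq1 x : (w x == 1) = (x == 1).
Proof.
by apply/eqP/eqP => [|->]; [case: wP => _ _ _; apply | apply: fchar1 wP].
Qed.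

Lemma sum_fcharX t : (0 < t)%N ->
  \sum_(x : K) w x ^+ t = if (N %| t)%N then N%:R else 0.
Proof.
move=> t0; have [g prim_g] := finField_prim_root K.
case: ifP => [/dvdnP[k tE]|Nt].
  rewrite (bigD1 0) //= (fchar0 wP) expr0n gtn_eqF // add0r tE.
  rewrite (eq_bigr (fun=> 1)) => [|x x0].
    by rewrite sumr_const -(cardC1 (0 : K)).
  by rewrite mulnC exprM -(fcharX wP) expf_card1 // (fchar1 wP) expr1n.
have g0 : g != 0.
  apply/eqP=> g0; have/eqP := prim_expr_order prim_g.
  by rewrite g0 expr0n gtn_eqF // eq_sym oner_eq0.
have wg : 1 - w g ^+ t != 0.
  by rewrite subr_eq0 eq_sym -(fcharX wP) fchar_eq1 -(prim_order_dvd prim_g) Nt.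
apply: (mulfI wg); rewrite mulr0 mulrBl mul1r.
rewrite [X in X - _](reindex_inj (mulfI g0)) /= mulr_sumr.
by under eq_bigr do rewrite (fcharM wP) exprMn; rewrite subrr.
Qed.

(** Orthogonality: on nonzero elements the average of the n powers w^(k m) detects x^m = 1. *)
Let s1 := [seq (n%:R^-1 : algC, (k * m)%N) | k <- iota 0 n].
(** One minus the detector of p-th powers in the subgroup of order m. Merging its k = 0 term into
    the constant lowers the absolute sum from 2 to 2 (1 - 1/p), and the product over p then produces
    phi(r)/r. *)
Let fac p := (1 - p%:R^-1 : algC, 0%N) ::
  [seq (- p%:R^-1 : algC, (k * (m %/ p))%N) | k <- iota 1 p.-1].
Let s2 := foldr char_mul s1 [seq fac p | p <- primes r].

Let evc_s1 x : x != 0 -> char_eval s1 (w x) = (x ^+ m == 1)%:R.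
Proof.
move=> x0; rewrite /char_eval big_map /= -mulr_sumr.
rewrite -{2}[n]subn0 -/(index_iota 0 n) big_mkord.
rewrite (eq_bigr (fun k : 'I_n => (w x ^+ m) ^+ k)) => [|k _]; last by rewrite mulnC exprM.
rewrite sum_geom_unity; last first.
  by rewrite -exprM mulnC -Nnm -(fcharX wP) expf_card1 // (fchar1 wP).
rewrite -(fcharX wP) fchar_eq1; case: eqP => _; last by rewrite mulr0.
by rewrite mulVf // pnatr_eq0 -lt0n.
Qed.

Let evc_fac p x : x ^+ m = 1 -> p \in primes r ->
  char_eval (fac p) (w x) = (x ^+ (m %/ p) != 1)%:R.
Proof.
move=> xm pr; have mp := prime_dvd_m rm pr.
have p0 : (0 < p)%N by move: pr; rewrite mem_primes => /and3P[/prime_gt0].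
rewrite /char_eval big_cons big_map /= mulr1 -mulr_sumr.
have <- : \sum_(k < p) w x ^+ (k * (m %/ p)) - 1 =
    \sum_(k <- iota 1 p.-1) w x ^+ (k * (m %/ p)).
  rewrite -(big_mkord xpredT (fun k => w x ^+ (k * (m %/ p)))) /index_iota subn0.
  by rewrite -{1}(prednK p0) /= big_cons mul0n expr0 addrC addKr.
rewrite (eq_bigr (fun k : 'I_p => (w x ^+ (m %/ p)) ^+ k)) => [|k _]; last first.
  by rewrite mulnC exprM.
rewrite sum_geom_unity; last by rewrite -exprM divnK // -(fcharX wP) xm (fchar1 wP).
have pn0 : p%:R != 0 :> algC by rewrite pnatr_eq0 -lt0n.
rewrite -(fcharX wP) fchar_eq1; case: eqP => _ /=.
  by rewrite mulrBr mulNr mulVf // mulr1; ring.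
by rewrite sub0r mulrN mulr1 opprK subrK.
Qed.

Let evc_s2 x : x != 0 -> char_eval s2 (w x) = (freeb n r x)%:R.
Proof.
move=> x0; have E0 : char_eval s2 (w x) = char_eval s1 (w x) * \prod_(p <- primes r) char_eval (fac p) (w x).
  rewrite /s2; elim: (primes r) => [|p ps IH]; first by rewrite big_nil mulr1.
  by rewrite big_cons /= evcM IH mulrCA.
rewrite E0 evc_s1 // /freeb x0 -/m /=; case: eqP => [xm|_]; last by rewrite mul0r.
rewrite mul1r /= big_seq (eq_bigr (fun p => (x ^+ (m %/ p) != 1)%:R)); last first.
  by move=> p; apply: evc_fac.
rewrite -big_seq; elim: (primes r) => [|p ps IH]; first by rewrite big_nil.
by rewrite big_cons IH /= -natrM mulnb.
Qed.

Let l1c_s2 : char_l1 s2 <= (W r)%:R * ((totient r)%:R / r%:R).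
Proof.
have l1s1 : char_l1 s1 = 1.
  rewrite /char_l1 big_map /= big_const_seq count_predT size_iota iter_addr_0.
  by rewrite /= ger0_norm ?invr_ge0 ?ler0n // -[LHS]mulr_natr mulVf // pnatr_eq0 -lt0n.
have l1f p : prime p -> char_l1 (fac p) = 2%:R * (1 - p%:R^-1).
  move=> pr_p; have p0 := prime_gt0 pr_p.
  have pn0 : p%:R != 0 :> algC by rewrite pnatr_eq0 -lt0n.
  rewrite /char_l1 big_cons big_map /= big_const_seq count_predT size_iota iter_addr_0 /=.
  rewrite normrN !ger0_norm ?invr_ge0 ?ler0n //; last first.
    by rewrite subr_ge0 invf_le1 ?ltr0n // ler1n.
  by rewrite -[_ *+ p.-1]mulr_natr -subn1 natrB // mulrBr mulr1 mulVf //; ring.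
have E0 : char_l1 s2 = 2 ^+ size (primes r) * \prod_(p <- primes r) (1 - p%:R^-1).
  rewrite /s2.
  have : {subset primes r <= prime} by move=> p; rewrite mem_primes => /andP[].
  elim: (primes r) => [|p ps IH] sub; first by rewrite big_nil mulr1 expr0 -[RHS]l1s1.
  rewrite /= l1cM IH => [|x xs]; last by apply: sub; rewrite inE xs orbT.
  have pr_p : prime p by apply: (sub p); rewrite mem_head.
  by rewrite (l1f _ pr_p) big_cons exprS; ring.
rewrite E0 totient_prod // ler_wpM2r ?divr_ge0 ?ler0n //.
by rewrite -natrX ler_nat exp2_primes_le_W.
Qed.

Lemma free_expansion : exists s : seq (algC * nat),
  [/\ {in s, forall c, 0 < c.2}%N,
      forall x, (freeb n r x)%:R = char_eval s (w x),
      char_l1 s <= (W r)%:R * ((totient r)%:R / r%:R) &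
      \sum_(c <- s | (N %| c.2)%N) c.1 = (totient r)%:R / (r * n)%:R].
Proof.
(* Adding N to the exponents changes nothing at nonzero x and makes every term vanish at 0, which is
   never free. *)
pose s := [seq (c.1, (c.2 + N)%N) | c <- s2].
have s_pos c : c \in s -> (0 < c.2)%N by case/mapP=> c' _ ->; rewrite addn_gt0 N0 orbT.
have evs x : (freeb n r x)%:R = char_eval s (w x).
  have [->|x0] := eqVneq x 0.
    rewrite (fchar0 wP) /freeb eqxx /= /char_eval big_map big1 // => c _ /=.
    by rewrite expr0n gtn_eqF ?mulr0 // addn_gt0 N0 orbT.
  rewrite -evc_s2 // /char_eval big_map; apply: eq_bigr => c _ /=.
  by rewrite exprD -[_ ^+ N](fcharX wP) expf_card1 // (fchar1 wP) mulr1.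
exists s; split=> //; first by rewrite /char_l1 big_map; apply: l1c_s2.
have Nn0 : N%:R != 0 :> algC by rewrite pnatr_eq0 -lt0n.
have rn0 : (r * n)%:R != 0 :> algC by rewrite pnatr_eq0 -lt0n muln_gt0 r0.
(* The total coefficient of the trivial character is found by summing over K: orthogonality isolates
   it, and [card_freeb] evaluates the sum. *)
have sumE : \sum_(x : K) char_eval s (w x) = N%:R * \sum_(c <- s | (N %| c.2)%N) c.1.
  rewrite exchange_big big_seq mulr_sumr [RHS]big_mkcond [RHS]big_seq /=.
  apply: eq_bigr => c /s_pos c0; rewrite -mulr_sumr sum_fcharX //.
  by case: ifP; rewrite ?mulr0 // mulrC.
apply: (mulfI Nn0); rewrite -sumE; under eq_bigr do rewrite -evs.
have cardE : (\sum_(x : K) freeb n r x = #|[set x : K | freeb n r x]|)%N.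
  by rewrite -sum1_card [RHS]big_mkcond; apply: eq_bigr => x _; rewrite inE; case: freeb.
apply: (mulIf rn0); rewrite -mulrA divfK // -natr_sum cardE -!natrM; congr _%:R.
by rewrite mulnA card_freeb // -/m {1}Nnm [RHS]mulnC mulnA mulnAC.
Qed.
End Indicator.

(** * Squarefree polynomials and their radical *)

Lemma deriv0_pchar_power (K : finFieldType) p (u : {poly K}) :
  p \in [pchar K] -> u^`() = 0 -> exists v, u = v ^+ p.
Proof.
move=> pK du0; have pr_p := pcharf_prime pK; have p0 := prime_gt0 pr_p.
have char_p : [pchar K].-nat p by rewrite pnatE.
have /fin_all_exists[a aE] : forall i : 'I_(size u), exists x, x ^+ p = u`_(i * p).
  by move=> i; apply: finField_root_surj.
exists (\sum_(i < size u) a i *: 'X^i).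
rewrite exprD_pchar_sum ?pnat_pchar_poly //; apply/polyP=> k.
under eq_bigr => i _ do rewrite exprZn -exprM aE.
rewrite coef_sum; have [/dvdnP[l ->]|pk] := boolP (p %| k)%N.
  have [lt|le] := ltnP l (size u).
    rewrite (bigD1 (Ordinal lt)) //= coefZ coefXn eqxx mulr1 big1 ?addr0 // => i neq.
    rewrite coefZ coefXn eqn_pmul2r // eq_sym.
    by rewrite -val_eqE /= in neq; rewrite (negPf neq) mulr0.
  rewrite nth_default ?(leq_trans le) ?leq_pmulr // big1 // => i _.
  rewrite coefZ coefXn eqn_pmul2r // gtn_eqF ?mulr0 //.
  exact: leq_trans (ltn_ord i) le.
rewrite big1 => [|i _]; last first.
  rewrite coefZ coefXn; case: eqP => [kE|_]; last by rewrite mulr0.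
  by rewrite kE dvdn_mull in pk.
case: k pk => [|k] pk; first by rewrite dvdn0 in pk.
have := congr1 (coefp k) du0; rewrite /= coef_deriv coef0 -mulr_natr => /eqP.
by rewrite mulf_eq0 -(dvdn_pcharf pK) (negPf pk) orbF => /eqP.
Qed.

(** Finite fields are perfect: a factor with zero derivative is a p-th power, hence is divisible by
    a square. *)
Lemma sqfree_separable (K : finFieldType) (f : {poly K}) :
  f != 0 -> sqfree_poly f -> separable_poly f.
Proof.
move=> f0 sq; apply/separable_polyP; split.
  apply/poly_square_freeP=> u u1; apply/negP=> uf.
  have := sq u; rewrite -expr2 => /(_ uf) szu.
  have u0 : u = 0 by apply/eqP; rewrite -size_poly_leq0 -ltnS ltn_neqAle u1.
  by move: uf; rewrite u0 expr0n /= dvd0p (negPf f0).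
move=> u uf szu; apply/eqP=> du0; have [p _ pK] := finPcharP K.
have [v uv] := deriv0_pchar_power pK du0.
have := sq v; have vf : v * v %| f.
  apply: dvdp_trans uf; rewrite uv -expr2 dvdp_exp2l //.
  exact: prime_gt1 (pcharf_prime pK).
move/(_ vf) => /size1_polyC vE; move: szu; rewrite uv vE -rmorphXn size_polyC.
by case: (_ != 0).
Qed.

(** P3 is the normalised gcd. Isolating it makes P1 P2 P3 the radical of f F, of degree D + 1, even
    when f and F share roots. *)
Lemma monic_coprime_decomposition (K : fieldType) (f F : {poly K}) :
  f != 0 -> F != 0 -> separable_poly f -> separable_poly F ->
  exists P1 P2 P3 : {poly K}, [/\ [/\ P1 \is monic, P2 \is monic & P3 \is monic],
    separable_poly (P1 * P2 * P3),
    f = lead_coef f *: (P1 * P3) & F = lead_coef F *: (P2 * P3)].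
Proof.
move=> f0 F0 sepf sepF; pose g := gcdp f F.
have g0 : g != 0 by rewrite gcdp_eq0 negb_and f0.
pose nrm (p : {poly K}) := (lead_coef p)^-1 *: p.
have nrmE p : p != 0 -> p = lead_coef p *: nrm p.
  by move=> p0; rewrite scalerA divff ?scale1r ?lead_coef_eq0.
have monN p : p != 0 -> nrm p \is monic.
  by move=> p0; rewrite monicE lead_coefZ mulVf ?lead_coef_eq0.
have eqN p : p != 0 -> nrm p %= p.
  by move=> p0; rewrite eqp_scale // invr_eq0 lead_coef_eq0.
have gf : nrm g %| nrm f by rewrite (eqp_dvdl _ (eqN _ g0)) (eqp_dvdr _ (eqN _ f0)) dvdp_gcdl.
have gF : nrm g %| nrm F by rewrite (eqp_dvdl _ (eqN _ g0)) (eqp_dvdr _ (eqN _ F0)) dvdp_gcdr.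
exists (nrm f %/ nrm g), (nrm F %/ nrm g), (nrm g).
have E1 : nrm f %/ nrm g * nrm g = nrm f by rewrite divpK.
have E2 : nrm F %/ nrm g * nrm g = nrm F by rewrite divpK.
rewrite E1 E2; split; try exact: nrmE.
  by split; [rewrite -(monicMr _ (monN _ g0)) E1 | rewrite -(monicMr _ (monN _ g0)) E2 |]; apply: monN.
have cop : coprimep (nrm f %/ nrm g) (nrm F %/ nrm g).
  rewrite (eqp_coprimepl _ (eqp_div (eqN _ f0) (eqN _ g0))).
  rewrite (eqp_coprimepr _ (eqp_div (eqN _ F0) (eqN _ g0))).
  by rewrite coprimep_div_gcd // f0.
have := eqp_separable (eqN _ f0); have := eqp_separable (eqN _ F0).
rewrite -E1 -E2 !separable_mul sepf sepF => /and3P[s2 _ c2] /and3P[s1 s3 c1].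
by rewrite E1 E2 s1 s2 s3 coprimepMl c1 c2 cop.
Qed.

Lemma size_radical (K : fieldType) (L : fieldExtType K) (P1 P2 P3 : {poly K}) (rs : seq L) :
  separable_poly (P1 * P2 * P3) ->
  map_poly (in_alg L) ((P1 * P3) * (P2 * P3)) %= \prod_(x <- rs) ('X - x%:P) ->
  size (P1 * P2 * P3)%R = (size (undup rs)).+1.
Proof.
set M := P1 * P2 * P3 => sep eq_rs.
have : map_poly (in_alg L) M %| \prod_(x <- rs) ('X - x%:P).
  rewrite -(eqp_dvdr _ eq_rs) dvdp_map; have -> : P1 * P3 * (P2 * P3) = P3 * M by rewrite /M; ring.
  exact: dvdp_mull.
case/dvdp_prod_XsubC=> msk eqM; set ms := mask msk rs in eqM.
have ums : uniq ms by rewrite -separable_prod_XsubC -(eqp_separable eqM) separable_map.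
rewrite -(size_map_poly (in_alg L)) (eqp_size eqM) size_prod_XsubC; congr _.+1.
apply: perm_size; apply: uniq_perm; rewrite ?undup_uniq // => x.
rewrite mem_undup -root_prod_XsubC -(eqp_root eqM) -[RHS]root_prod_XsubC -(eqp_root eq_rs).
rewrite /M !rmorphM /= !rootM.
by case: (root _ x); case: (root _ x); case: (root _ x).
Qed.

(** * The estimate *)

Section Estimate.
Variables (K : finFieldType) (w : K -> algC) (f F P1 P2 P3 : {poly K}) (cf cF : K) (D : nat).
Hypothesis wP : faithful_char w.
Notation q := #|K|.
Notation N := (#|K|.-1).
Hypotheses (q5 : (5 <= q)%N) (D1 : (1 <= D)%N).
Hypotheses (mon1 : P1 \is monic) (mon2 : P2 \is monic) (mon3 : P3 \is monic).
Hypothesis sep : separable_poly (P1 * P2 * P3).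
Hypotheses (nc1 : (1 < size (P1 * P3)%R)%N) (nc2 : (1 < size (P2 * P3)%R)%N).
Hypothesis neq : (P1 != 1) || (P2 != 1).
Hypotheses (cf0 : cf != 0) (cF0 : cF != 0).
Hypotheses (fE : f = cf *: (P1 * P3)) (FE : F = cF *: (P2 * P3)).
Hypothesis szM : size (P1 * P2 * P3)%R = D.+2.

Let S t t' := \sum_(x : K) w f.[x] ^+ t * w F.[x] ^+ t'.
Let X : algC := D%:R * sqrtC q%:R.

Let q0 : 0 < q%:R :> algC. Proof. by rewrite ltr0n (leq_trans _ q5). Qed.

Let S_bound t t' : (0 < t)%N -> (0 < t')%N -> ~~ ((N %| t) && (N %| t'))%N -> `|S t t'| <= X.
Proof.
move=> t0 t0' nontriv.
have -> : S t t' = w (cf ^+ t * cF ^+ t') *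
   \sum_(x : K) w ((P1 * P3).[x] ^+ t * (P2 * P3).[x] ^+ t').
  rewrite mulr_sumr; apply: eq_bigr => x _.
  rewrite -!(fcharX wP) -!(fcharM wP) fE FE !hornerZ !exprMn; congr (w _); ring.
rewrite normrM (norm_fchar wP) ?mulf_neq0 ?expf_neq0 // mul1r.
apply: le_trans (weil_bound wP mon1 mon2 mon3 sep nc1 nc2 neq nontriv t0 t0') _.
by rewrite szM.
Qed.

Let S_triv t t' : (0 < t)%N -> (0 < t')%N -> (N %| t)%N -> (N %| t')%N -> `|S t t' - q%:R| <= X.
Proof.
move=> t0 t0' /dvdnP[k tE] /dvdnP[k' tE'].
have wt y : w y ^+ t = (y != 0)%:R.
  have [->|y0] := eqVneq y 0; first by rewrite (fchar0 wP) expr0n gtn_eqF.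
  by rewrite tE mulnC exprM -(fcharX wP) expf_card1 // (fchar1 wP) expr1n.
have wt' y : w y ^+ t' = (y != 0)%:R.
  have [->|y0] := eqVneq y 0; first by rewrite (fchar0 wP) expr0n gtn_eqF.
  by rewrite tE' mulnC exprM -(fcharX wP) expf_card1 // (fchar1 wP) expr1n.
pose Z := #|[pred x : K | root (P1 * P2 * P3) x]|.
have SE : S t t' - q%:R = - Z%:R.
  apply/eqP; rewrite subr_eq addrC eq_sym subr_eq; apply/eqP.
  have -> : Z%:R = \sum_(x : K) (root (P1 * P2 * P3) x)%:R :> algC.
    by rewrite /Z -sum1_card natr_sum big_mkcond; apply: eq_bigr => x _; rewrite inE; case: root.
  rewrite -big_split /= -[q]sum1_card natr_sum; apply: eq_bigr => x _.
  rewrite wt wt' fE FE !hornerZ !mulf_eq0 (negPf cf0) (negPf cF0) /= !hornerM !mulf_eq0.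
  rewrite !rootM !rootE.
  by case: (P1.[x] == 0); case: (P2.[x] == 0); case: (P3.[x] == 0); rewrite /= ?mulr0 ?mulr1 ?mul0r ?addr0 ?add0r.
rewrite SE normrN normr_nat.
have ZD : (Z <= D.+1)%N.
  rewrite -ltnS -szM /Z cardE; apply: max_poly_roots; rewrite ?enum_uniq //.
    exact: separable_poly_neq0.
  by apply/allP=> x; rewrite mem_enum.
(* The trivial pair misses q by the number of zeros, at most D + 1 <= 2 D, and sqrt q >= 2 brings
   this within D sqrt q. *)
have le2 : 2 <= sqrtC q%:R :> algC.
  rewrite -(ler_pXn2r (_ : 0 < 2)%N) ?nnegrE ?sqrtC_ge0 ?ler0n // sqrtCK -natrX ler_nat.
  by apply: leq_trans q5.
apply: le_trans (_ : D%:R * 2 <= _); last by rewrite ler_wpM2l ?ler0n.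
by rewrite -natrM ler_nat (leq_trans ZD) // muln2 -addnn -addn1 leq_add2l.
Qed.

(** In the product of the two expansions the pairs of trivial characters contribute c q, and each
    pair, trivial or not, errs by at most X times its coefficients. The product of the two absolute
    sums is c n n' W(r) W(r'). *)
Lemma free_pair_estimate n r n' r' (A : {set K}) :
  (n %| N)%N -> (n' %| N)%N -> (r %| N %/ n)%N -> (r' %| N %/ n')%N ->
  (forall x, (x \in A) = freeb n r f.[x] && freeb n' r' F.[x]) ->
  `|#|A|%:R - (totient r * totient r')%:R / (r * n * r' * n')%:R * q%:R|
    <= (totient r * totient r')%:R / (r * n * r' * n')%:R * ((n * n' * W r * W r')%:R * X).
Proof.
move=> nN nN' rm rm' AE; set c : algC := _ / _.
have [s [s_pos evs l1s sums]] := free_expansion wP nN rm.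
have [s' [s_pos' evs' l1s' sums']] := free_expansion wP nN' rm'.
set al := (totient r)%:R / (r * n)%:R in sums; set be := (totient r')%:R / (r' * n')%:R in sums'.
have N0 : (0 < N)%N by rewrite -ltnS prednK ?(leq_trans _ q5) // ltnW ?(leq_trans _ q5).
have n0 := dvdn_gt0 N0 nN; have n0' := dvdn_gt0 N0 nN'.
have cE : c = al * be.
  by rewrite /c /al /be mulf_div !natrM; congr (_ / _); ring.
have X0 : 0 <= X by rewrite mulr_ge0 ?ler0n ?sqrtC_ge0.
have al0 : 0 <= al by rewrite divr_ge0 ?ler0n.
have be0 : 0 <= be by rewrite divr_ge0 ?ler0n.
have AS : #|A|%:R = \sum_(c <- s) \sum_(d <- s') c.1 * d.1 * S c.2 d.2.
  transitivity (\sum_(x : K) char_eval s (w f.[x]) * char_eval s' (w F.[x])).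
    rewrite -sum1_card natr_sum big_mkcond; apply: eq_bigr => x _.
    by rewrite -evs -evs' -natrM mulnb AE; case: (_ && _).
  under eq_bigr do rewrite mulr_suml.
  rewrite exchange_big; apply: eq_bigr => c1 _.
  under eq_bigr do rewrite mulr_sumr.
  rewrite exchange_big; apply: eq_bigr => d1 _.
  by rewrite mulr_sumr; apply: eq_bigr => x _; rewrite mulrACA.
pose b (c1 d1 : algC * nat) := (N %| c1.2)%N && (N %| d1.2)%N.
have cqE : c * q%:R = \sum_(c <- s) \sum_(d <- s') c.1 * d.1 * (if b c d then q%:R else 0).
  rewrite cE -sums -sums' [in LHS]big_mkcond [X in _ * X * _]big_mkcond /= 2!mulr_suml.
  apply: eq_bigr => c1 _; rewrite mulr_sumr mulr_suml; apply: eq_bigr => d1 _.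
  by rewrite /b; case: (N %| c1.2)%N; case: (N %| d1.2)%N; rewrite /= ?(mulr0, mul0r).
rewrite AS cqE -sumrB.
under eq_bigr do rewrite -sumrB.
apply: le_trans (_ : \sum_(c <- s) \sum_(d <- s') `|c.1| * `|d.1| * X <= _).
  apply: le_trans (ler_norm_sum _ _ _) _; rewrite big_seq [X in _ <= X]big_seq.
  apply: ler_sum => c1 /s_pos c0.
  apply: le_trans (ler_norm_sum _ _ _) _; rewrite big_seq [X in _ <= X]big_seq.
  apply: ler_sum => d1 /s_pos' d0.
  rewrite -mulrBr !normrM ler_wpM2l ?mulr_ge0 //.
  rewrite /b; case: ifP => [/andP[Nc Nd]|/negbT nb]; first exact: S_triv.
  by rewrite subr0; apply: S_bound.
have -> : \sum_(c <- s) \sum_(d <- s') `|c.1| * `|d.1| * X = char_l1 s * char_l1 s' * X.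
  rewrite /char_l1 !mulr_suml; apply: eq_bigr => c1 _.
  by rewrite mulr_sumr mulr_suml.
rewrite [c * _]mulrA ler_wpM2r //.
apply: le_trans (ler_pM _ _ l1s l1s') _; try by apply: sumr_ge0.
rewrite le_eqVlt; apply/orP; left; apply/eqP.
have n0C : n%:R != 0 :> algC by rewrite pnatr_eq0 -lt0n.
have n0C' : n'%:R != 0 :> algC by rewrite pnatr_eq0 -lt0n.
have r0 : r%:R != 0 :> algC by rewrite pnatr_eq0 -lt0n (dvdn_gt0 _ rm) // divn_gt0 // dvdn_leq.
have r0' : r'%:R != 0 :> algC by rewrite pnatr_eq0 -lt0n (dvdn_gt0 _ rm') // divn_gt0 // dvdn_leq.
by rewrite /c !natrM; field; rewrite r0 r0' n0C n0C'.
Qed.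
End Estimate.

Theorem theorem4p2 (K : finFieldType) (n N r R : nat)
  (f F : {poly K}) (L : fieldExtType K) (rs : seq L) (D : nat)
  (T : rcfType) (A : {set K}) :
  (5 <= #|K|)%N ->
  (n %| Qord K)%N -> (N %| Qord K)%N ->
  (r %| Qord K %/ n)%N -> (R %| Qord K %/ N)%N ->
  (1 < size f)%N -> (1 < size F)%N ->
  sqfree_poly f -> sqfree_poly F ->
  ~ (exists c : K, f = c *: F) ->
  map_poly (in_alg L) (f * F) %= \prod_(x <- rs) ('X - x%:P) ->
  D.+1 = size (undup rs) ->
  (1 <= D)%N ->
  (* A = set of theta with f(theta) (r,n)-free and F(theta) (R,N)-free *)
  (forall theta : K, theta \in A <-> (rn_free r n f.[theta] /\ rn_free R N F.[theta])) ->
  exists H : T,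
    #|A|%:R
      = (totient r * totient R)%:R / (r * n * R * N)%:R * (#|K|%:R + H)
    /\ `|H| <= (D * n * N * W r * W R)%:R * Num.sqrt (#|K|%:R).
Proof.
move=> q5 nQ NQ rm Rm szf szF sqf sqF nprop splitL sizeD D1 AP.
have f0 : f != 0 by rewrite -size_poly_gt0 ltnW.
have F0 : F != 0 by rewrite -size_poly_gt0 ltnW.
have lf0 : lead_coef f != 0 by rewrite lead_coef_eq0.
have lF0 : lead_coef F != 0 by rewrite lead_coef_eq0.
have [P1 [P2 [P3 [[mon1 mon2 mon3] sep fE FE]]]] :=
  monic_coprime_decomposition f0 F0 (sqfree_separable f0 sqf) (sqfree_separable F0 sqF).
have nc1 : (1 < size (P1 * P3)%R)%N by rewrite -(size_scale _ lf0) -fE.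
have nc2 : (1 < size (P2 * P3)%R)%N by rewrite -(size_scale _ lF0) -FE.
have neq : (P1 != 1) || (P2 != 1).
  rewrite -negb_and; apply/negP=> /andP[/eqP p1 /eqP p2]; apply: nprop.
  exists (lead_coef f / lead_coef F).
  by rewrite {1}fE {2}FE p1 p2 scalerA divfK.
have szM : size (P1 * P2 * P3)%R = D.+2.
  rewrite (size_radical (L := L) (rs := rs) sep) ?sizeD // -(eqp_rtrans splitL) eqp_map.
  rewrite fE FE -scalerAl -scalerAr scalerA eqp_sym eqp_scale // mulf_neq0 //.
have AE x : (x \in A) = freeb n r f.[x] && freeb N R F.[x].
  apply/idP/andP => [/AP [/(rn_freeP nQ rm) -> /(rn_freeP NQ Rm) ->] //|[a1 a2]].
  by apply/AP; split; apply/rn_freeP.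
have [w wP] := faithful_char_exists K.
have := free_pair_estimate wP q5 D1 mon1 mon2 mon3 sep nc1 nc2 neq lf0 lF0 fE FE szM
  nQ NQ rm Rm AE.
set a := (totient r * totient R)%N; set b := (r * n * R * N)%N => est.
have Q0 : (0 < Qord K)%N by rewrite /Qord -ltnS prednK ?(leq_trans _ q5).
have n0 := dvdn_gt0 Q0 nQ; have N0 := dvdn_gt0 Q0 NQ.
have r0 : (0 < r)%N by apply: dvdn_gt0 rm; rewrite divn_gt0 // dvdn_leq.
have R0 : (0 < R)%N by apply: dvdn_gt0 Rm; rewrite divn_gt0 // dvdn_leq.
have a0 : (0 < a)%N by rewrite muln_gt0 !totient_gt0 r0.
have b0 : (0 < b)%N by rewrite !muln_gt0 r0 n0 R0.
(* The equation forces H, and its value is rational. Squaring removes the square root from the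
   bound, so that it passes from algC to T through the rationals. *)
pose h : rat := #|A|%:R / (a%:R / b%:R) - #|K|%:R.
set M := (D * n * N * W r * W R)%N.
have ratr_h2 (U : numFieldType) : ratr (h ^+ 2) = ratr h ^+ 2 :> U by rewrite rmorphXn.
have ratr_M2 (U : numFieldType) :
    ratr (M%:R ^+ 2 * #|K|%:R) = M%:R ^+ 2 * #|K|%:R :> U.
  by rewrite rmorphM rmorphXn /= !rmorph_nat.
have hM : h ^+ 2 <= M%:R ^+ 2 * #|K|%:R.
  have c0 : 0 < a%:R / b%:R :> algC by rewrite divr_gt0 ?ltr0n.
  have hC : ratr h = #|A|%:R / (a%:R / b%:R) - #|K|%:R :> algC.
    by rewrite /h rmorphB /= !fmorph_div !rmorph_nat.
  have le_h : `|ratr h : algC| <= M%:R * sqrtC #|K|%:R.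
    rewrite -(ler_pM2l c0) -{1}[a%:R / b%:R]gtr0_norm // -normrM hC.
    rewrite mulrBr [_ * (_ / _)]mulrC divfK ?gt_eqF //; apply: le_trans est _.
    rewrite le_eqVlt; apply/orP; left; apply/eqP; congr (_ * _).
    by rewrite mulrA -natrM; congr (_%:R * _); rewrite /M mulnC !mulnA.
  rewrite -(ler_rat algC) ratr_h2 ratr_M2.
  rewrite -real_normK ?Creal_Rat ?rpred_rat //.
  rewrite -[X in _ <= _ * X]sqrtCK -exprMn ler_pXn2r ?nnegrE ?normr_ge0 //.
  by rewrite mulr_ge0 ?ler0n ?sqrtC_ge0.
have ab0 : a%:R / b%:R != 0 :> T by rewrite mulf_neq0 ?invr_eq0 ?pnatr_eq0 -?lt0n.
have hT : ratr h = #|A|%:R / (a%:R / b%:R) - #|K|%:R :> T.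
  by rewrite /h rmorphB /= !fmorph_div !rmorph_nat.
exists (ratr h); split.
  by rewrite hT addrCA subrr addr0 mulrC divfK.
rewrite -(ler_pXn2r (_ : 0 < 2)%N) ?nnegrE ?normr_ge0 ?mulr_ge0 ?ler0n ?sqrtr_ge0 //.
rewrite real_normK ?num_real // [X in _ <= X]exprMn sqr_sqrtr ?ler0n //.
by move: hM; rewrite -(ler_rat T) ratr_h2 ratr_M2.
Qed.
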